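(* Write $\eta_u=\eta(u,0)$ and assume each coordinate $u_a$ is a polynomial in $\eta_u$, i.e. $u\in\mathbb{R}[\eta_u]$. Let $\tilde e_1(\eta),\dots,\tilde e_p(\eta)\in\mathbb{R}[\eta]^d$ be such that $\tilde e_1(\eta_u),\dots,\tilde e_p(\eta_u)$ span $((\nabla_u\eta(u,0))^{\perp_{\bar G}})^{\perp_E}$ for every $u$. Let $$\mathcal{I}_2=\langle (X_i-\eta_i)(X_j-\eta_j)\mid 1\le i,j\le d\rangle\subset\mathbb{R}[X,\eta]=\mathbb{R}[X_1,\dots,X_d,\eta_1,\dots,\eta_d],$$ let $\prec$ be the pure lexicographic monomial order with $\eta_1\succ\dots\succ\eta_d\succ X_1\succ\dots\succ X_d$, let $G_\prec$ be a Gröbner basis of $\mathcal{I}_2$ with respect to $\prec$, and for $i=1,\dots,p$ let $r_i\in\mathbb{R}[X,\eta]$ be the normal form (remainder) of $(X-\eta)^\top\tilde e_i(\eta)$ with respect to $G_\prec$. Then: (i) for $i=1,\dots,p$, $r_i$ has degree at most $1$ with respect to $\eta$ (total degree in $\eta_1,\dots,\eta_d$); (ii) $r_i(X,\eta_u)=0$, $i=1,\dots,p$, are the estimating equations for a first-order efficient estimator.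
   Context: Full exponential family: $dP(x|\theta)=\exp(\sum_i x_i\theta^i-\psi(\theta))\,d\nu$, $x\in\mathbb{R}^d$, $\theta\in\Theta\subset\mathbb{R}^d$, with smooth potential $\psi$. The expectation parameter is $\eta(\theta)=\nabla_\theta\psi(\theta)$, locally invertible. The Fisher metric with respect to $\theta$ is $g_{ij}=\partial^2\psi/\partial\theta^i\partial\theta^j$ (positive definite), and $\bar G(\eta)=(g^{ij})$ is its inverse matrix, the Fisher metric with respect to $\eta$. The model is an algebraic curved exponential family of dimension $p<d$ with expectation parameter space $\mathcal{V}_E\subset\mathbb{R}^d$, nonsingular around the true parameter; here algebraic means that $\mathcal V_E$ or the natural parameter space is a real algebraic variety and the relation between $\theta$ and $\eta$ is locally given by polynomial equations. $u\mapsto\eta(u,0)$, $u$ in a subset of $\mathbb{R}^p$, is a regular parametrization of $\mathcal{V}_E$ around the true parameter. $X\in\mathbb{R}^d$ denotes the sample mean. $(\nabla_u\eta(u,0))^{\perp_{\bar G}}$ is the subspace of $\mathbb{R}^d$ orthogonal, with respect to $\bar G(\eta(u,0))$, to $\mathrm{span}(\partial_{u^a}\eta(u,0))_{a=1}^p$; $(\cdot)^{\perp_E}$ is the Euclidean orthogonal complement. An estimator is given by a local coordinate system $(u,v)\in\mathbb{R}^p\times\mathbb{R}^{d-p}$, $(u,v)\mapsto\eta(u,v)\in\mathbb{R}^d$ (smooth), around the true parameter, extending the parametrization $\eta(u,0)$ of $\mathcal{V}_E$; the estimate from $X=\eta(u,v)$ is $u$. The estimator defined by a system of equations in $(X,u)$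 (its estimating equations) is such a coordinate system (with any choice of the coordinates $v$) for which the equations hold identically when $X=\eta(u,v)$ is substituted. The estimator is first-order efficient if and only if $$g_{\kappa a}\big|_{v=0}=\left.\left(\frac{\partial\eta(u,v)}{\partial v^\kappa}\right)^{\!\top}\bar G(\eta(u,v))\,\frac{\partial\eta(u,v)}{\partial u^a}\right|_{v=0}=0\quad\text{for all }\kappa\in\{1,\dots,d-p\},\ a\in\{1,\dots,p\};$$ this criterion is taken as the definition. *)

(* Defs.v *)
From HB Require Import structures.
From mathcomp Require Import all_boot all_order all_algebra.
From mathcomp Require Import all_classical all_reals all_analysis.
(* The notations of mpoly clash with those of MathComp-Analysis: [mpoly n R] is
   {mpoly R[n]}, [multinom n] is 'X_{1..n}, [meval v f] is f.@[v], [lem] is the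
   divisibility order on monomials. *)
From mathcomp.multinomials Require Export -(notations) mpoly.

Set Implicit Arguments.
Unset Strict Implicit.
Unset Printing Implicit Defensive.

Import Order.TTheory GRing.Theory Num.Theory.
Import numFieldNormedType.Exports.

Local Open Scope classical_set_scope.
Local Open Scope ring_scope.

(* Vectors of R^n are rows.  Row i of the library Jacobian ['J f x] is the
   partial derivative of f in the i-th coordinate (acting on rows on the right),
   that is, the transpose of the usual Jacobian matrix. *)

Fixpoint Ck (R : realType) (V W : normedModType R) (k : nat)
    (U : set V) (f : V -> W) : Prop :=
  match k with
  | 0 => forall x, U x -> {for x, continuous f}
  | k'.+1 => (forall x, U x -> differentiable f x)
             /\ (forall h : V, Ck k' U (fun x => 'D_h f x))
  end.

Definition smooth_on (R : realType) (V W : normedModType R)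
    (U : set V) (f : V -> W) : Prop := forall k, Ck k U f.

Definition grad (R : realType) (n : nat) (f : 'rV[R]_n -> R) (x : 'rV[R]_n) :
  'rV[R]_n := \row_i 'D_(delta_mx 0 i) f x.

Definition hessian (R : realType) (n : nat) (f : 'rV[R]_n -> R)
    (x : 'rV[R]_n) : 'M[R]_n :=
  \matrix_(i, j) 'D_(delta_mx 0 i) (fun y => 'D_(delta_mx 0 j) f y) x.

Definition positive_definite (R : realType) (n : nat) (A : 'M[R]_n) : Prop :=
  forall x : 'rV[R]_n, x != 0 -> 0 < (x *m A *m x^T) 0 0.

Definition borel_space (R : realType) (n : nat) :=
  g_sigma_algebraType (@open 'rV[R]_n).

Record exponential_family (R : realType) (d : nat)
    (nu : {measure set (borel_space R d) -> \bar R})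
    (Theta : set 'rV[R]_d) (psi : 'rV[R]_d -> R) : Prop := {
  expfam_open : open Theta ;
  expfam_smooth : smooth_on Theta psi ;
  (* exp(<x, theta> - psi theta) dnu is a probability measure *)
  expfam_density : forall theta, Theta theta ->
    (\int[nu]_x
       (expR ((\sum_i (x : 'rV[R]_d) 0 i * theta 0 i) - psi theta))%:E = 1)%E ;
  expfam_fisher : forall theta, Theta theta ->
    positive_definite (hessian psi theta)
}.

Definition expectation_space (R : realType) (d : nat) (Theta : set 'rV[R]_d)
    (psi : 'rV[R]_d -> R) : set 'rV[R]_d := grad psi @` Theta.

(* [th] is a local inverse of theta |-> eta(theta), defined on the open set H;
   it selects the branch along which the metric is read as a function of eta. *)
Record local_inverse (R : realType) (d : nat) (Theta : set 'rV[R]_d)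
    (psi : 'rV[R]_d -> R) (H : set 'rV[R]_d) (th : 'rV[R]_d -> 'rV[R]_d) :
  Prop := {
  linv_open : open H ;
  linv_dom : forall eta, H eta -> Theta (th eta) ;
  linv_grad : forall eta, H eta -> grad psi (th eta) = eta ;
  linv_cont : forall eta, H eta -> {for eta, continuous th}
}.

Definition Gbar (R : realType) (d : nat) (psi : 'rV[R]_d -> R)
    (th : 'rV[R]_d -> 'rV[R]_d) (eta : 'rV[R]_d) : 'M[R]_d :=
  invmx (hessian psi (th eta)).

Definition peval (R : realType) (n : nat) (f : mpoly n R) (x : 'rV[R]_n) : R :=
  meval (fun i => x 0 i) f.

(* R[X, eta] is [mpoly (d + d) R] with the variables listed as
   eta_1, ..., eta_d, X_1, ..., X_d. *)
Definition etav (R : realType) (d : nat) (i : 'I_d) : mpoly (d + d) R :=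
  mpolyX R (mnm1 (lshift d i)).

Definition Xv (R : realType) (d : nat) (i : 'I_d) : mpoly (d + d) R :=
  mpolyX R (mnm1 (rshift d i)).

Definition in_eta (R : realType) (d : nat) (f : mpoly d R) : mpoly (d + d) R :=
  comp_mpoly [tuple etav R i | i < d] f.

Definition eval_X_eta (R : realType) (d : nat) (f : mpoly (d + d) R)
    (X eta : 'rV[R]_d) : R := peval f (row_mx eta X).

Definition eta_degree_le (R : realType) (d : nat) (k : nat)
    (f : mpoly (d + d) R) : Prop :=
  forall m, m \in msupp f -> (\sum_(i < d) m (lshift d i) <= k)%N.

Definition ideal_gen (R : realType) (n : nat) (S : set (mpoly n R)) :
  set (mpoly n R) :=
  [set f | exists2 s : seq (mpoly n R * mpoly n R),
     (forall q, q \in s -> S q.2) & f = \sum_(q <- s) q.1 * q.2].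

(* Pure lexicographic order with variable 0 > variable 1 > ..., so that on
   [mpoly (d + d) R] eta_1 > ... > eta_d > X_1 > ... > X_d. *)
Definition lex_lt (n : nat) (m1 m2 : multinom n) : Prop :=
  exists2 i : 'I_n, (forall j : 'I_n, (j < i)%N -> m1 j = m2 j)
                  & (m1 i < m2 i)%N.

Definition leading_monomial (R : realType) (n : nat) (f : mpoly n R)
    (m : multinom n) : Prop :=
  m \in msupp f /\
  (forall m', m' \in msupp f -> m' = m \/ lex_lt m' m).

Record groebner_basis (R : realType) (n : nat) (I : set (mpoly n R))
    (G : seq (mpoly n R)) : Prop := {
  groebner_sub : forall g, g \in G -> I g ;
  groebner_lead : forall f m, I f -> leading_monomial f m ->
    exists g m', [/\ g \in G, leading_monomial g m' & lem m' m]
}.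

Record normal_form (R : realType) (n : nat) (G : seq (mpoly n R))
    (f r : mpoly n R) : Prop := {
  nf_congr : ideal_gen [set g | g \in G] (f - r) ;
  nf_reduced : forall g m m', g \in G -> leading_monomial g m ->
    m' \in msupp r -> ~~ lem m m'
}.

Definition I2 (R : realType) (d : nat) : set (mpoly (d + d) R) :=
  ideal_gen [set f | exists i j : 'I_d,
    f = (Xv R i - etav R i) * (Xv R j - etav R j)].

Definition linear_form (R : realType) (d : nat) (e : 'I_d -> mpoly d R) :
  mpoly (d + d) R :=
  \sum_(j < d) (Xv R j - etav R j) * in_eta (e j).

Definition poly_jacobian (R : realType) (n : nat) (fs : seq (mpoly n R))
    (x : 'rV[R]_n) : 'M[R]_(size fs, n) :=
  \matrix_(i < size fs, j < n) peval (mderiv j fs`_i) x.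

(* V is the trace on D of a real algebraic variety, nonsingular of dimension p
   around x (Jacobian criterion). *)
Definition nonsingular_variety (R : realType) (n p : nat) (D V : set 'rV[R]_n)
    (x : 'rV[R]_n) : Prop :=
  exists fs : seq (mpoly n R),
    V = [set y | D y /\ forall f, f \in fs -> peval f y = 0] /\
    (\forall y \near x, V y -> \rank (poly_jacobian fs y) = (n - p)%N).

Definition natural_space (R : realType) (d : nat) (Theta : set 'rV[R]_d)
    (psi : 'rV[R]_d -> R) (VE : set 'rV[R]_d) : set 'rV[R]_d :=
  [set theta | Theta theta /\ VE (grad psi theta)].

(* Around the point (tstar, grad psi tstar), polynomial equations h(theta, eta)
   = 0 cut out the relation eta = grad psi theta on V_N x V_E. *)
Definition algebraic_relation (R : realType) (d : nat) (Theta : set 'rV[R]_d)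
    (psi : 'rV[R]_d -> R) (VE : set 'rV[R]_d) (tstar : 'rV[R]_d) : Prop :=
  exists hs : seq (mpoly (d + d) R),
    \forall theta \near tstar & eta \near grad psi tstar,
      natural_space Theta psi VE theta -> VE eta ->
      ((forall h, h \in hs -> peval h (row_mx theta eta) = 0)
       <-> grad psi theta = eta).

Record algebraic_curved_family (R : realType) (d p : nat)
    (Theta : set 'rV[R]_d) (psi : 'rV[R]_d -> R) (VE : set 'rV[R]_d)
    (tstar : 'rV[R]_d) : Prop := {
  acf_sub : VE `<=` expectation_space Theta psi ;
  acf_variety :
    nonsingular_variety p (expectation_space Theta psi) VE (grad psi tstar)
    \/ nonsingular_variety p Theta (natural_space Theta psi VE) tstar ;
  acf_relation : algebraic_relation Theta psi VE tstar
}.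

Record regular_parametrization (R : realType) (d p : nat)
    (VE : set 'rV[R]_d) (U0 : set 'rV[R]_p) (ustar : 'rV[R]_p)
    (eta0 : 'rV[R]_p -> 'rV[R]_d) : Prop := {
  rparam_open : open U0 ;
  rparam_true : U0 ustar ;
  rparam_smooth : smooth_on U0 eta0 ;
  rparam_inj : forall u u', U0 u -> U0 u' -> eta0 u = eta0 u' -> u = u' ;
  rparam_rank : forall u, U0 u -> \rank ('J eta0 u) = p ;
  rparam_image : forall u, U0 u -> VE (eta0 u) ;
  rparam_onto : \forall y \near eta0 ustar,
    VE y -> exists2 u, U0 u & eta0 u = y
}.

(* Rows spanning the orthogonal complement of the row space of A for the
   bilinear form of matrix M: { w | w M a^T = 0 for all rows a of A }. *)
Definition orth (R : realType) (d m : nat) (M : 'M[R]_d) (A : 'M[R]_(m, d)) :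
  'M[R]_d := kermx (M *m A^T).

(* Coordinates are written row_mx u v with u in R^p and v in R^(d-p). *)
Record estimator (R : realType) (d p : nat) (U0 : set 'rV[R]_p)
    (ustar : 'rV[R]_p) (eta0 : 'rV[R]_p -> 'rV[R]_d)
    (W : set 'rV[R]_(p + (d - p)))
    (eta : 'rV[R]_(p + (d - p)) -> 'rV[R]_d) : Prop := {
  est_open : open W ;
  est_true : W (row_mx ustar 0) ;
  est_smooth : smooth_on W eta ;
  est_inj : forall w w', W w -> W w' -> eta w = eta w' -> w = w' ;
  est_rank : forall w, W w -> \rank ('J eta w) = d ;
  est_dom : forall u v, W (row_mx u v) -> U0 u ;
  est_extends : forall u, W (row_mx u 0) -> eta (row_mx u 0) = eta0 u
}.

Definition satisfies_equations (R : realType) (d p : nat)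
    (F : 'I_p -> 'rV[R]_d -> 'rV[R]_p -> R)
    (W : set 'rV[R]_(p + (d - p)))
    (eta : 'rV[R]_(p + (d - p)) -> 'rV[R]_d) : Prop :=
  forall u v, W (row_mx u v) -> forall i, F i (eta (row_mx u v)) u = 0.

(* g_{kappa a} = 0 at v = 0, the rows of the Jacobian being the partial
   derivatives of eta in u_a (first p rows) and v_kappa (last d - p rows). *)
Definition first_order_efficient (R : realType) (d p : nat)
    (G : 'rV[R]_d -> 'M[R]_d)
    (W : set 'rV[R]_(p + (d - p)))
    (eta : 'rV[R]_(p + (d - p)) -> 'rV[R]_d) : Prop :=
  forall u, W (row_mx u 0) ->
  forall (kappa : 'I_(d - p)) (a : 'I_p),
    (row (rshift p kappa) ('J eta (row_mx u 0))
       *m G (eta (row_mx u 0))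
       *m (row (lshift (d - p) a) ('J eta (row_mx u 0)))^T) 0 0 = 0.

(* An estimator with these estimating equations exists, and every choice of the
   coordinates v gives a first-order efficient one. *)
Definition estimating_equations_for_first_order_efficient (R : realType)
    (d p : nat) (U0 : set 'rV[R]_p) (ustar : 'rV[R]_p)
    (eta0 : 'rV[R]_p -> 'rV[R]_d) (G : 'rV[R]_d -> 'M[R]_d)
    (F : 'I_p -> 'rV[R]_d -> 'rV[R]_p -> R) : Prop :=
  (exists W eta, estimator U0 ustar eta0 W eta /\ satisfies_equations F W eta)
  /\ (forall W eta, estimator U0 ustar eta0 W eta ->
        satisfies_equations F W eta -> first_order_efficient G W eta).

(* Main.v *)
Require Import Defs.
From HB Require Import structures.
From mathcomp Require Import all_boot all_order all_algebra.
From mathcomp Require Import all_classical all_reals all_analysis.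
From mathcomp Require Import ring lra.
Import Order.TTheory GRing.Theory Num.Theory.
Import numFieldNormedType.Exports.
Local Open Scope classical_set_scope.
Local Open Scope ring_scope.

(** Write Y = X - eta_u and E(u) for the matrix of rows e_i(eta_u).

    Degree.  The generator (X_i - eta_i)(X_j - eta_j) has leading monomial
    eta_i eta_j, so some leading monomial of the Groebner basis divides
    eta_i eta_j, and a reduced remainder contains no monomial divisible by it:
    [normal_form_eta_degree].

    Equations.  The remainder differs from the linear form by an element of
    I_2, and such an element vanishes to second order on the diagonal X = eta.
    So r_i = sum_j (X_j - eta_j) c_ij, where c_ij agrees with e_ij on the
    diagonal ([normal_form_diagonal]), and the estimating equations read
    Y C(u, X)^T = 0 with C(u, eta_u) = E(u).  For fixed u they define a leaf
    through eta_u, and the leaves play the part of the sets of equal estimate.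

    Efficiency.  Differentiating Y C(u, X)^T = 0 along v at v = 0, where Y
    vanishes, gives (d eta / dv) E(u)^T = 0 ([leaf_tangent]).  The rows of E(u)
    span the Euclidean complement of the Gbar-orthogonal of the tangent space
    of the model, so every vector that they annihilate is Gbar-orthogonal to
    the model ([double_orth_annihilator]).

    Existence.  Let J be the Jacobian of u |-> eta_u.  Since Gbar is positive
    definite, J E^T is invertible ([transversality]): the leaf is transversal to
    the model at eta_u.  Choose Q with Q E^T = 1 at the true parameter.  The map
    (u, X) |-> (u, Y + Y (C(u, X) - E)^T Q) has an invertible derivative there,
    and it sends the leaf of u to the fixed linear space ker E^T, because the
    second component times E^T is Y C(u, X)^T.  The inverse function theorem
    ([inverse_function]) turns linear coordinates v on ker E^T into smooth
    coordinates on the leaves, with v = 0 on the model.  That (u, v) |-> eta is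
    injective of full rank near the true parameter follows from its Jacobian
    there ([local_immersion], [leaf_coordinates]).

    The calculus behind this is the algebra of C^k maps and the inverse
    function theorem, which rests on the mean value inequality and the
    contraction principle. *)

Set Implicit Arguments.
Unset Strict Implicit.
Unset Printing Implicit Defensive.

(** * Remainders modulo I_2 *)

Lemma ideal_gen_ind (R : realType) n (S P : set (mpoly n R)) :
  P 0 -> (forall f g, P f -> P g -> P (f + g)) ->
  (forall a f, S f -> P (a * f)) -> ideal_gen S `<=` P.
Proof.
move=> P0 PD PM _ [s sS ->]; elim: s sS => [|q s IH] sS; first by rewrite big_nil.
rewrite big_cons; apply: PD; first by apply/PM/sS; rewrite mem_head.
by apply: IH => q' q's; apply: sS; rewrite in_cons q's orbT.
Qed.

Lemma mem_ideal_gen (R : realType) n (S : set (mpoly n R)) f : S f -> ideal_gen S f.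
Proof.
move=> Sf; exists [:: (1, f)]; last by rewrite big_seq1 mul1r.
by move=> q; rewrite inE => /eqP ->.
Qed.

Section Algebra.
Context {R : realType} {d : nat}.
Implicit Types (i j : 'I_d) (f g h : mpoly (d + d) R).

Local Notation mul_mnm i j := (mnm_add (mnm1 i) (mnm1 j)).

Definition quadric i j : mpoly (d + d) R :=
  (Xv R i - etav R i) * (Xv R j - etav R j).

Lemma quadricE i j : quadric i j =
  mpolyX R (mul_mnm (lshift d i) (lshift d j))
  - mpolyX R (mul_mnm (rshift d i) (lshift d j))
  - mpolyX R (mul_mnm (lshift d i) (rshift d j))
  + mpolyX R (mul_mnm (rshift d i) (rshift d j)).
Proof.
by rewrite !mpolyXD /quadric /Xv /etav; ring.
Qed.

(** The variables eta_i precede all X_j, so replacing an eta by an X lowers a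
    monomial: the first place where the exponents differ is the index of the
    replaced eta, or the smaller of the two indices when both are replaced. *)
Lemma leading_monomial_quadric i j :
  leading_monomial (quadric i j) (mul_mnm (lshift d i) (lshift d j)).
Proof.
split.
  rewrite mcoeff_msupp quadricE mcoeffD !mcoeffB !mcoeffX eqxx.
  have nl (a : 'I_d) c :
      (mul_mnm (rshift d a) c == mul_mnm (lshift d i) (lshift d j)) = false.
    apply/eqP => /(congr1 (fun m : multinom (d + d) => m (rshift d a))).
    by rewrite !mnmDE !mnm1E eqxx !eq_lrshift.
  have -> : mul_mnm (lshift d i) (rshift d j) =
      mul_mnm (rshift d j) (lshift d i).
    by apply/mnmP => k; rewrite !mnmDE addnC.
  by rewrite !nl !subr0 addr0 oner_eq0.
move=> m; rewrite mcoeff_msupp quadricE mcoeffD !mcoeffB !mcoeffX => m0.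
have : m \in [:: mul_mnm (lshift d i) (lshift d j);
    mul_mnm (rshift d i) (lshift d j); mul_mnm (lshift d i) (rshift d j);
    mul_mnm (rshift d i) (rshift d j)].
  apply: contraNT m0; rewrite !inE !negb_or => /and4P[m1 m2 m3 m4].
  rewrite ![_ == m]eq_sym (negbTE m1) (negbTE m2) (negbTE m3) (negbTE m4) /=.
  by rewrite !subr0 addr0.
have below (k : 'I_(d + d)) a : (k < lshift d a)%N ->
   ((lshift d a == k) = false) * forall b, (rshift d b == k) = false.
  move=> ka; split=> [|b]; apply/eqP => E; move: ka; rewrite -E ?ltnn //=.
  by rewrite ltnNge (leq_trans (ltnW (ltn_ord a)) (leq_addr _ _)).
rewrite !inE => /or4P[]/eqP->; first by left.
- right; exists (lshift d i).
    by move=> k /below ik; rewrite !mnmDE !mnm1E !ik.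
  by rewrite !mnmDE !mnm1E eqxx eq_rlshift.
- right; exists (lshift d j).
    by move=> k /below jk; rewrite !mnmDE !mnm1E !jk.
  by rewrite !mnmDE !mnm1E eqxx eq_rlshift !addn0 addn1.
right; have [ij|ji] := leqP i j.
  exists (lshift d i); last by rewrite !mnmDE !mnm1E eqxx !eq_rlshift.
  move=> k ki; have kj : (k < lshift d j)%N by exact: leq_trans ki ij.
  by rewrite !mnmDE !mnm1E !(below _ _ ki) !(below _ _ kj).
exists (lshift d j); last by rewrite !mnmDE !mnm1E eqxx !eq_rlshift addn1.
move=> k kj; have ki : (k < lshift d i)%N by exact: ltn_trans kj ji.
by rewrite !mnmDE !mnm1E !(below _ _ ki) !(below _ _ kj).
Qed.

Lemma eta_degree_ge2 (m : multinom (d + d)) :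
  (1 < \sum_(i < d) m (lshift d i))%N ->
  exists i j, mpoly.lem (mul_mnm (lshift d i) (lshift d j)) m.
Proof.
move=> m2.
have [i mi] : exists i, m (lshift d i) != 0%N.
  apply/existsP; apply: contraLR m2 => /existsPn m0.
  by rewrite big1 // => i _; apply/eqP/negPn/m0.
rewrite (bigD1 i) //= in m2.
have [mi2|mi1] := leqP 2 (m (lshift d i)).
  exists i, i; apply/mnm_lepP => k; rewrite !mnmDE !mnm1E.
  by case: eqP => [<-|].
have [j /andP[ji mj]] : exists j, (j != i) && (m (lshift d j) != 0%N).
  apply/existsP; apply: contraLR m2 => /existsPn m0.
  rewrite big1 ?addn0 -?leqNgt // => j ji; apply/eqP/negPn.
  by have := m0 j; rewrite ji.
exists i, j; apply/mnm_lepP => k; rewrite !mnmDE !mnm1E.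
case: eqP => [<-|_]; last by case: eqP => [<-|//]; rewrite lt0n.
by rewrite eq_lshift (negbTE ji) addn0 lt0n.
Qed.

(** A monomial of eta-degree at least 2 is divisible by some eta_i eta_j, the
    leading monomial of a generator of I_2, hence by a leading monomial of the
    basis, which a reduced remainder excludes. *)
Lemma normal_form_eta_degree (G : seq (mpoly (d + d) R)) f r :
  groebner_basis (@I2 R d) G -> normal_form G f r -> eta_degree_le 1 r.
Proof.
move=> [_ lead] [_ reduced] m mr; rewrite leqNgt; apply/negP.
move=> /eta_degree_ge2[i [j ijm]].
have I2ij : I2 (quadric i j) by apply: mem_ideal_gen; exists i, j.
have [g [m' [gG gm' m'ij]]] := lead _ _ I2ij (leading_monomial_quadric i j).
by have := reduced _ _ _ gG gm' mr; rewrite (lepm_trans m'ij ijm).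
Qed.

Lemma eval_in_eta (q : mpoly d R) (X eta : 'rV[R]_d) :
  eval_X_eta (in_eta q) X eta = peval q eta.
Proof.
rewrite /eval_X_eta /peval /in_eta comp_mpoly_meval; apply: meval_eq => i.
by rewrite tnth_mktuple /etav mevalXU row_mxEl.
Qed.

Lemma eval_Xv i (X eta : 'rV[R]_d) : eval_X_eta (Xv R i) X eta = X 0 i.
Proof. by rewrite /eval_X_eta /peval /Xv mevalXU row_mxEr. Qed.

Lemma eval_etav i (X eta : 'rV[R]_d) : eval_X_eta (etav R i) X eta = eta 0 i.
Proof. by rewrite /eval_X_eta /peval /etav mevalXU row_mxEl. Qed.

(** The polynomials that vanish on the diagonal X = eta, with their cofactors
    exposed: the values of the cofactors on the diagonal are minus the partial
    derivatives in eta, which is all that first-order efficiency sees. *)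
Definition diagonal_form (c : 'I_d -> mpoly (d + d) R) : mpoly (d + d) R :=
  \sum_j (Xv R j - etav R j) * c j.

Lemma eval_diagonal_form c (X eta : 'rV[R]_d) :
  eval_X_eta (diagonal_form c) X eta =
  \sum_j (X - eta) 0 j * eval_X_eta (c j) X eta.
Proof.
rewrite /eval_X_eta /peval /diagonal_form raddf_sum /=; apply: eq_bigr => j _.
rewrite mevalM mevalB -![meval _ _]/(eval_X_eta _ X eta) eval_Xv eval_etav.
by rewrite !mxE.
Qed.

(** Second-order vanishing on the diagonal: in a generator
    (X_i - eta_i)(X_j - eta_j), the second factor serves as the cofactor of the
    first and is itself zero on the diagonal. *)
Lemma I2_vanishes_twice f : I2 f ->
  exists2 c, f = diagonal_form c & forall j x, eval_X_eta (c j) x x = 0.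
Proof.
move: f; apply: ideal_gen_ind.
- exists (fun=> 0); first by rewrite /diagonal_form big1 // => j _; rewrite mulr0.
  by move=> j x; rewrite /eval_X_eta /peval meval0.
- move=> _ _ [c1 -> c10] [c2 -> c20]; exists (fun j => c1 j + c2 j).
    by rewrite /diagonal_form -big_split; apply: eq_bigr => j _; rewrite mulrDr.
  move=> j x; rewrite /eval_X_eta /peval mevalD.
  by rewrite -![meval _ _]/(eval_X_eta _ x x) c10 c20 addr0.
move=> a _ [i [j ->]].
exists (fun k => if k == i then a * (Xv R j - etav R j) else 0).
  rewrite /diagonal_form (bigD1 i) //= eqxx big1 ?addr0 => [|k /negbTE ->].
    by rewrite mulrCA.
  by rewrite mulr0.
move=> k x; case: eqP => _; rewrite /eval_X_eta /peval ?meval0 //.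
rewrite mevalM mevalB -![meval _ _]/(eval_X_eta _ x x) eval_Xv eval_etav.
by rewrite subrr mulr0.
Qed.

(** Reduction modulo I_2 changes the cofactors of X_j - eta_j only by
    polynomials that vanish on the diagonal, so it keeps the first-order
    behaviour of the linear form along the model. *)
Lemma normal_form_diagonal (G : seq (mpoly (d + d) R)) (e : 'I_d -> mpoly d R) r :
  groebner_basis (@I2 R d) G -> normal_form G (linear_form e) r ->
  exists2 c, r = diagonal_form c &
    forall j x, eval_X_eta (c j) x x = peval (e j) x.
Proof.
move=> [GI2 _] [congr_r _].
have : I2 (linear_form e - r).
  apply: ideal_gen_ind congr_r.
  - by exists [::] => //; rewrite big_nil.
  - move=> _ _ [s1 S1 ->] [s2 S2 ->]; exists (s1 ++ s2); last by rewrite big_cat.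
    by move=> q; rewrite mem_cat => /orP[/S1|/S2].
  move=> a g /GI2[s sS ->]; exists [seq (a * q.1, q.2) | q <- s].
    by move=> _ /mapP[q qs ->]; exact: (sS q qs).
  by rewrite mulr_sumr big_map; apply: eq_bigr => q _; rewrite mulrA.
move=> /I2_vanishes_twice[c fr c0].
exists (fun j => in_eta (e j) - c j).
  rewrite -[LHS](subKr (linear_form e)) fr -sumrB.
  by apply: eq_bigr => j _; rewrite mulrBr.
move=> j x; rewrite /eval_X_eta /peval mevalB -![meval _ _]/(eval_X_eta _ x x).
by rewrite c0 eval_in_eta subr0.
Qed.

End Algebra.

(** * Calculus of C^k maps *)

Section Differentiability.
Context {R : realType}.
Implicit Types V W : normedModType R.

(** Together with its converse below, it trades the little-o formulation for
    explicit estimates, which combine more easily with Lipschitz bounds. *)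
Lemma differentiable_eps V W (f : V -> W) x : differentiable f x ->
  forall e, 0 < e ->
  \forall y \near x, `|f y - f x - 'd f x (y - x)| <= e * `|y - x|.
Proof.
move=> /diff_locally /eqaddoP fx e e0.
rewrite (near_shift 0 x) /= subr0; apply: filterS (fx e e0) => y /=.
by rewrite !fctE /= addrK opprD addrA.
Qed.

Lemma differentiable_of_eps V W (f : V -> W) (L : {linear V -> W}) x :
  continuous L ->
  (forall e, 0 < e ->
    \forall y \near x, `|f y - f x - L (y - x)| <= e * `|y - x|) ->
  differentiable f x /\ 'd f x = L :> (V -> W).
Proof.
move=> cL fx.
have E : f \o shift x = cst (f x) + L +o_ 0 id.
  apply/eqaddoP => e e0; have := fx e e0; rewrite (near_shift 0 x) /= subr0.
  by apply: filterS => y /=; rewrite !fctE /= addrK opprD addrA.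
have D := diff_unique cL E.
by split=> //; apply/diff_locallyP; rewrite D.
Qed.

Lemma near_eq_differentiable V W (f g : V -> W) x :
  (\forall y \near x, f y = g y) -> differentiable f x -> differentiable g x.
Proof.
move=> fg df.
have [] // := @differentiable_of_eps _ _ g ('d f x) x _ _.
  exact: diff_continuous.
move=> e e0; rewrite -(nbhs_singleton fg).
by apply: filterS2 fg (differentiable_eps df e0) => y ->.
Qed.

End Differentiability.

Section SmoothFunctions.
Context {R : realType} {V : normedModType R} (U : set V).
Hypothesis openU : open U.
Implicit Types W : normedModType R.

Lemma Ck_differentiable W k (f : V -> W) x :
  Ck k.+1 U f -> U x -> differentiable f x.
Proof. by move=> [+ _] => /[apply]. Qed.

(** Openness is what makes the derivatives of two maps that agree on the domain
    agree there too. *)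
Lemma Ck_ext W k (f g : V -> W) :
  (forall x, U x -> f x = g x) -> Ck k U f -> Ck k U g.
Proof.
have near_fg W' (f' g' : V -> W') : (forall x, U x -> f' x = g' x) ->
    forall x, U x -> \forall y \near x, f' y = g' y.
  by move=> fg x Ux; apply: filterS fg _; exact: open_nbhs_nbhs.
elim: k f g => [|k IH] f g fg /=.
  move=> cf x Ux; rewrite /prop_for /continuous_at -fg //.
  apply: cvg_trans (cf x Ux); apply: near_eq_cvg.
  exact: near_fg.
move=> [df cf]; split=> [x Ux|h].
  by apply: near_eq_differentiable (df x Ux); exact: near_fg.
apply: IH (cf h) => x Ux; apply: near_eq_derive; exact: near_fg.
Qed.

Lemma Ck_pred W k (f : V -> W) : Ck k.+1 U f -> Ck k U f.
Proof.
elim: k f => [|k IH] f [df cf].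
  by move=> x Ux; exact/differentiable_continuous/df.
by split=> // h; apply: IH.
Qed.

Lemma Ck_cst W k (c : W) : Ck k U (fun=> c).
Proof.
elim: k c => [|k IH] c; first by move=> x _; exact: cvg_cst.
split=> [x _|h]; first exact: differentiable_cst.
by apply: Ck_ext (IH 0) => x _; rewrite derive_cst.
Qed.

Lemma Ck_linear W W' k (L : {linear W -> W'}) (f : V -> W) :
  continuous L -> Ck k U f -> Ck k U (fun x => L (f x)).
Proof.
move=> cL; elim: k f => [|k IH] f.
  move=> cf x Ux; apply: continuous_comp; first exact: cf.
  exact: cL.
have dL y : differentiable L y by exact: linear_differentiable.
move=> [df cf]; split=> [x Ux|h].
  by apply: differentiable_comp => //; exact: df.
apply: Ck_ext (IH _ (cf h)) => x Ux.
have dfx := df x Ux.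
rewrite [RHS]deriveE; last exact: differentiable_comp.
by rewrite (diff_comp dfx) //= diff_lin // deriveE.
Qed.

Lemma Ck_id k : Ck k U (fun x : V => x).
Proof.
case: k => [|k]; first by move=> x _; exact: cvg_id.
split=> [x _|h]; first exact: (@ex_diff _ _ _ _ _ id id).
by apply: Ck_ext (Ck_cst k h) => x _; rewrite [RHS]derive_id.
Qed.

Lemma Ck_D W k (f g : V -> W) :
  Ck k U f -> Ck k U g -> Ck k U (fun x => f x + g x).
Proof.
elim: k f g => [|k IH] f g.
  by move=> cf cg x Ux; apply: cvgD; [exact: cf | exact: cg].
move=> [df cf] [dg cg]; split=> [x Ux|h].
  by apply: differentiableD; [exact: df | exact: dg].
apply: Ck_ext (IH _ _ (cf h) (cg h)) => x Ux; rewrite [RHS]deriveD //.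
- by apply/diff_derivable/df.
- by apply/diff_derivable/dg.
Qed.

Lemma Ck_M k (f g : V -> R) :
  Ck k U f -> Ck k U g -> Ck k U (fun x => f x * g x).
Proof.
elim: k f g => [|k IH] f g.
  by move=> cf cg x Ux; apply: cvgM; [exact: cf | exact: cg].
move=> cf cg; split=> [x Ux|h].
  apply: differentiableM; first exact: Ck_differentiable cf Ux.
  exact: Ck_differentiable cg Ux.
have := Ck_D (IH _ _ (Ck_pred cf) (proj2 cg h)) (IH _ _ (Ck_pred cg) (proj2 cf h)).
apply: Ck_ext => x Ux; rewrite [RHS]deriveM //.
- exact/diff_derivable/(Ck_differentiable cf Ux).
- exact/diff_derivable/(Ck_differentiable cg Ux).
Qed.

Lemma Ck_V k (f : V -> R) : (forall x, U x -> f x != 0) ->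
  Ck k U f -> Ck k U (fun x => (f x)^-1).
Proof.
move=> f0; elim: k => [|k IH].
  by move=> cf x Ux; apply: cvgV; [exact: f0 | exact: cf].
move=> cf; split=> [x Ux|h].
  by apply: differentiableV; [exact: Ck_differentiable cf Ux | exact: f0].
have cV := IH (Ck_pred cf).
have := Ck_M (@Ck_cst R k (-1)) (Ck_M (Ck_M cV cV) (proj2 cf h)).
apply: Ck_ext => x Ux; rewrite [RHS]deriveV ?f0 //; last first.
  exact/diff_derivable/(Ck_differentiable cf Ux).
by rewrite mulN1r scaleNr expr2 invfM.
Qed.

Lemma Ck_sum W k (I : Type) (s : seq I) (P : pred I) (F : I -> V -> W) :
  (forall i, P i -> Ck k U (F i)) -> Ck k U (fun x => \sum_(i <- s | P i) F i x).
Proof.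
move=> cF; elim: s => [|i s IH].
  by apply: Ck_ext (@Ck_cst _ k 0) => x _; rewrite big_nil.
have [Pi|nPi] := boolP (P i).
  by apply: Ck_ext (Ck_D (cF i Pi) IH) => x _; rewrite big_cons Pi.
by apply: Ck_ext IH => x _; rewrite big_cons (negbTE nPi).
Qed.

Lemma Ck_prod k (I : Type) (s : seq I) (P : pred I) (F : I -> V -> R) :
  (forall i, P i -> Ck k U (F i)) -> Ck k U (fun x => \prod_(i <- s | P i) F i x).
Proof.
move=> cF; elim: s => [|i s IH].
  by apply: Ck_ext (@Ck_cst R k 1) => x _; rewrite big_nil.
have [Pi|nPi] := boolP (P i).
  by apply: Ck_ext (Ck_M (cF i Pi) IH) => x _; rewrite big_cons Pi.
by apply: Ck_ext IH => x _; rewrite big_cons (negbTE nPi).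
Qed.

Lemma Ck_coord k m n (f : V -> 'M[R]_(m, n)) i j :
  Ck k U f -> Ck k U (fun x => f x i j).
Proof.
pose g (N : 'M[R]_(m, n)) : R := N i j.
have gl : linear g by move=> a u v; rewrite /g !mxE.
pose gL : {linear 'M[R]_(m, n) -> R} :=
  HB.pack g (GRing.isLinear.Build _ _ _ _ _ gl).
move=> cf; apply: (@Ck_linear _ _ k gL f) => //; exact: coord_continuous.
Qed.

Lemma coord_Ck k n (f : V -> 'rV[R]_n) :
  (forall j, Ck k U (fun x => f x 0 j)) -> Ck k U f.
Proof.
move=> cf.
have H j : Ck k U (fun x => f x 0 j *: delta_mx 0 j : 'rV[R]_n).
  pose g (t : R) : 'rV[R]_n := t *: delta_mx 0 j.
  have gl : linear g by move=> a u v; rewrite /g scalerDl scalerA.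
  pose gL : {linear R -> 'rV[R]_n} := HB.pack g (GRing.isLinear.Build _ _ _ _ _ gl).
  apply: (@Ck_linear _ _ k gL) => //.
  exact: scalel_continuous.
have := @Ck_sum _ k _ (index_enum 'I_n) predT _ (fun j _ => H j).
by apply: Ck_ext => x _; rewrite [RHS]row_sum_delta.
Qed.

Lemma Ck_det k n (M : V -> 'M[R]_n) :
  (forall i j, Ck k U (fun x => M x i j)) -> Ck k U (fun x => \det (M x)).
Proof.
move=> cM; rewrite /determinant; apply: Ck_sum => s _.
by apply: Ck_M; [exact: Ck_cst | apply: Ck_prod].
Qed.

(** Cramer's rule: the entries of the inverse are polynomials in the entries
    divided by the determinant. *)
Lemma Ck_invmx k n (M : V -> 'M[R]_n) :
  (forall x, U x -> M x \in unitmx) ->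
  (forall i j, Ck k U (fun x => M x i j)) ->
  forall i j, Ck k U (fun x => invmx (M x) i j).
Proof.
move=> uM cM i j.
have dM x : U x -> \det (M x) != 0 by move=> /uM; rewrite unitmxE unitfE.
apply: (@Ck_ext _ _ (fun x => (\det (M x))^-1 *
    ((-1) ^+ (j + i) * \det (row' j (col' i (M x)))))).
  by move=> x Ux; rewrite /invmx uM // !mxE.
apply: Ck_M; first by apply: Ck_V => //; exact: Ck_det.
apply: Ck_M; first exact: Ck_cst.
apply: Ck_det => a b.
by apply: Ck_ext (cM (lift j a) (lift i b)) => x _; rewrite !mxE.
Qed.

End SmoothFunctions.

Section Composition.
Context {R : realType} {V : normedModType R}.

(** The chain rule expresses a directional derivative of the composite as a sum
    of products of directional derivatives of the inner map with composites of
    partial derivatives of the outer map, so the induction on k runs over all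
    outer functions at once. *)
Lemma Ck_comp k n (U : set V) (U' : set 'rV[R]_n) (g : V -> 'rV[R]_n)
    (f : 'rV[R]_n -> R) : open U -> open U' -> (forall x, U x -> U' (g x)) ->
  Ck k U g -> Ck k U' f -> Ck k U (fun x => f (g x)).
Proof.
move=> oU oU' gU; elim: k f => [|k IH] f.
  move=> cg cf x Ux; apply: continuous_comp; first exact: cg.
  exact/cf/gU.
move=> cg cf; have dg := Ck_differentiable cg; have df := Ck_differentiable cf.
split=> [x Ux|h].
  by apply: differentiable_comp; [exact: dg | exact/df/gU].
have H j : Ck k U (fun x : V => 'D_h g x 0 j * 'D_(delta_mx 0 j) f (g x)).
  apply: Ck_M => //; first by apply: Ck_coord => //; exact: (proj2 cg h).
  by apply: (IH ('D_(delta_mx 0 j) f)); [exact: Ck_pred cg | exact: (proj2 cf _)].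
have := @Ck_sum _ _ _ oU _ k _ (index_enum 'I_n) predT _ (fun j _ => H j).
move=> cS; apply: Ck_ext cS => // x Ux; rewrite [RHS]deriveE; last first.
  by apply: differentiable_comp; [exact: dg | exact/df/gU].
rewrite (diff_comp (dg x Ux) (df _ (gU x Ux))) /= -(@deriveE _ _ _ g x h (dg x Ux)).
rewrite [in RHS](row_sum_delta ('D_h g x)) linear_sum; apply: eq_bigr => j _.
by rewrite linearZ /= (deriveE _ (df _ (gU x Ux))).
Qed.

Lemma Ck_peval k n (U : set V) (g : V -> 'rV[R]_n) (q : mpoly n R) :
  open U -> Ck k U g -> Ck k U (fun x => peval q (g x)).
Proof.
move=> oU cg; rewrite /peval /meval /mmap; apply: Ck_sum => // m _.
apply: Ck_M => //; first exact: Ck_cst.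
apply: Ck_prod => // i _.
elim: (m i) => [|e IH]; first exact: Ck_cst.
apply: Ck_ext (Ck_M oU (Ck_coord oU 0 i cg) IH) => // x _.
by rewrite exprS.
Qed.

End Composition.

Section MatrixCalculus.
Context {R : realType} {V : normedModType R}.

Lemma Ck_subset (W : normedModType R) k (U U' : set V) (f : V -> W) :
  U' `<=` U -> Ck k U f -> Ck k U' f.
Proof.
move=> UU; elim: k f => [|k IH] f; first by move=> cf x /UU; exact: cf.
by move=> [df cf]; split=> [x Ux|h]; [exact/df/UU | exact/IH/cf].
Qed.

Lemma Ck_mulmx (U : set V) k m n q (A : V -> 'M[R]_(m, n)) (B : V -> 'M[R]_(n, q)) :
  open U -> (forall i j, Ck k U (fun x => A x i j)) ->
  (forall i j, Ck k U (fun x => B x i j)) ->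
  forall i j, Ck k U (fun x => (A x *m B x) i j).
Proof.
move=> oU cA cB i j.
have := @Ck_sum _ _ _ oU _ k _ (index_enum 'I_n) predT _
  (fun l _ => Ck_M oU (cA i l) (cB l j)).
by apply: (Ck_ext oU) => x _; rewrite mxE.
Qed.

Lemma Ck_row_mx (U : set V) k m n (f : V -> 'rV[R]_m) (g : V -> 'rV[R]_n) :
  open U -> Ck k U f -> Ck k U g -> Ck k U (fun x => row_mx (f x) (g x)).
Proof.
move=> oU cf cg; apply: (coord_Ck oU) => j; rewrite -(splitK j).
case: (fintype.split j) => i /=.
  by apply: (Ck_ext oU) (Ck_coord oU 0 i cf) => x _; rewrite row_mxEl.
by apply: (Ck_ext oU) (Ck_coord oU 0 i cg) => x _; rewrite row_mxEr.
Qed.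

Lemma is_derive_mulmx m n q (A : V -> 'M[R]_(m, n)) (B : V -> 'M[R]_(n, q))
    x h dA dB : is_derive x h A dA -> is_derive x h B dB ->
  is_derive x h (fun y => A y *m B y) (dA *m B x + A x *m dB).
Proof.
move=> [dAx <-] [dBx <-].
have dAij i j := (derivable_mxP _ _ _).1 dAx i j.
have dBij i j := (derivable_mxP _ _ _).1 dBx i j.
have entry i j : is_derive x h (fun y => (A y *m B y) i j)
    (('D_h A x *m B x + A x *m 'D_h B x) i j).
  have D := @is_derive_sum _ _ _ n (fun l y => A y i l * B y l j) x h _
    (fun l => is_deriveM (derivableP (dAij i l)) (derivableP (dBij l j))).
  rewrite [F in is_derive _ _ F _](_ : _ =
      \sum_(l < n) (fun y => A y i l * B y l j)).
    apply: is_derive_eq D _; rewrite [RHS]mxE !mxE -big_split.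
    apply: eq_bigr => l _ /=; rewrite (derive_mx dAx) (derive_mx dBx) !mxE.
    by rewrite addrC; congr (_ + _); rewrite mulrC.
  by apply/funext => y; rewrite mxE fct_sumE.
have dAB : derivable (fun y => A y *m B y) x h.
  by apply/derivable_mxP => i j; exact: (@ex_derive _ _ _ _ _ _ _ (entry i j)).
apply: DeriveDef => //; rewrite derive_mx //; apply/matrixP => i j.
by rewrite mxE; exact: derive_val.
Qed.

Lemma is_derive_linear (W : normedModType R) (L : {linear V -> W}) x h :
  continuous L -> is_derive x h L (L h).
Proof.
move=> cL; have dL : differentiable L x by exact: linear_differentiable.
by apply: DeriveDef; [exact: diff_derivable | rewrite deriveE // diff_lin].
Qed.

Lemma is_derive_comp (W W' : normedModType R) (f : V -> W) (g : W -> W') x h :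
  differentiable f x -> differentiable g (f x) ->
  is_derive x h (fun y => g (f y)) ('d g (f x) ('D_h f x)).
Proof.
move=> df dg; have dgf := differentiable_comp df dg.
apply: DeriveDef; first exact: diff_derivable.
by rewrite deriveE // diff_comp //= deriveE.
Qed.

Lemma is_derive_linear_comp (W W' : normedModType R) (L : {linear W -> W'})
    (f : V -> W) x h : continuous L -> differentiable f x ->
  is_derive x h (fun y => L (f y)) (L ('D_h f x)).
Proof.
move=> cL df; have dL : differentiable L (f x) by exact: linear_differentiable.
by have := is_derive_comp h df dL; rewrite diff_lin.
Qed.

Lemma is_derive_unique (W : normedModType R) (f : V -> W) x h a b :
  is_derive x h f a -> is_derive x h f b -> a = b.
Proof. by move=> [_ <-] [_ <-]. Qed.

End MatrixCalculus.

(** * Strict differentiability and the inverse function theorem *)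

Section MatrixNorm.
Context {R : realType}.

Lemma mx_subE m n (A B : 'M[R]_(m, n)) i j : (A - B) i j = A i j - B i j.
Proof. by rewrite !mxE. Qed.

Lemma mx_norm_entry_le m n (A : 'M[R]_(m, n)) i j : `|A i j| <= `|A|.
Proof. by rewrite {2}/Num.Def.normr /= mx_normrE (le_bigmax _ _ (i, j)). Qed.

Lemma mx_norm_le m n (A : 'M[R]_(m, n)) c :
  0 <= c -> (forall i j, `|A i j| <= c) -> `|A| <= c.
Proof.
by move=> c0 Ac; rewrite /Num.Def.normr /= mx_normrE bigmax_le.
Qed.

Lemma mulmx_norm_le m n (x : 'rV[R]_m) (A : 'M[R]_(m, n)) :
  `|x *m A| <= m%:R * `|A| * `|x|.
Proof.
apply: mx_norm_le => [|i j]; first by rewrite !mulr_ge0.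
rewrite mxE (le_trans (ler_norm_sum _ _ _)) //.
rewrite -mulrA mulr_natl -[X in _ *+ X](card_ord m) -sumr_const ler_sum // => k _.
by rewrite normrM mulrC ler_pM // mx_norm_entry_le.
Qed.

Lemma mulmxr_continuous m n (A : 'M[R]_(m, n)) :
  continuous (mulmxr A : 'rV[R]_m -> 'rV[R]_n).
Proof.
have K0 : 0 < m%:R * `|A| + 1 by rewrite ltr_wpDl // mulr_ge0.
apply: continuousfor0_continuous.
apply/(@cvgrPdist_le _ _ _ (nbhs (0 : 'rV[R]_m))) => e e0.
have : \forall x \near (0 : 'rV[R]_m), `|x| <= e / (m%:R * `|A| + 1).
  by apply: nbhs0_le; rewrite divr_gt0.
apply: filterS => x; rewrite ler_pdivlMr // => xe.
rewrite linear0 sub0r normrN (le_trans (mulmx_norm_le _ _)) //.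
by rewrite mulrC (le_trans _ xe) // ler_wpM2l // lerDl.
Qed.

Lemma row_free_of_ker m n (A : 'M[R]_(m, n)) :
  (forall v : 'rV_m, v *m A = 0 -> v = 0) -> row_free A.
Proof.
move=> A0; rewrite -kermx_eq0; apply/eqP/row_matrixP => i.
by rewrite row0; apply: A0; rewrite -row_mul mulmx_ker row0.
Qed.

End MatrixNorm.

Section Jacobian.
Context {R : realType}.

Lemma jacobian_row m n (f : 'rV[R]_m -> 'rV[R]_n) x i :
  differentiable f x -> row i ('J f x) = 'D_(delta_mx 0 i) f x.
Proof. by move=> df; rewrite deriveEjacobian // rowE. Qed.

Lemma jacobianE m n (f : 'rV[R]_m -> 'rV[R]_n) x i j :
  differentiable f x -> 'J f x i j = ('D_(delta_mx 0 i) f x) 0 j.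
Proof. by move=> df; rewrite -jacobian_row // [RHS]mxE. Qed.

Lemma jacobian_near m n (U : set 'rV[R]_m) (f : 'rV[R]_m -> 'rV[R]_n) x0 :
  open U -> U x0 -> Ck 1 U f ->
  forall e, 0 < e -> \forall x \near x0, `|'J f x - 'J f x0| <= e.
Proof.
move=> oU Ux0 [df cf] e e0.
have H i : \forall x \near x0,
    `|'D_(delta_mx 0 i) f x0 - 'D_(delta_mx 0 i) f x| <= e.
  by have /cvgrPdist_le := cf (delta_mx 0 i) x0 Ux0; apply.
have nU : \forall x \near x0, U x by exact: open_nbhs_nbhs.
apply: filterS2 nU (filter_forall _ H) => x Ux Hx.
apply: mx_norm_le => [|i j]; first exact: ltW.
have -> : ('J f x - 'J f x0) i j =
    ('D_(delta_mx 0 i) f x) 0 j - ('D_(delta_mx 0 i) f x0) 0 j.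
  by rewrite mx_subE; congr (_ - _); apply: jacobianE; exact: df.
rewrite distrC; apply: le_trans (Hx i).
by apply: le_trans (mx_norm_entry_le _ 0 j); rewrite mx_subE.
Qed.

(** The one-variable mean value theorem applies to each coordinate of
    t |-> f(y + t(x - y)) - t (x - y) A, whose derivative is
    (x - y) ('J f - A).  Comparison with a fixed matrix A is what yields strict
    differentiability.  The factor m comes from the sup norm. *)
Lemma mean_value_ineq m n (f : 'rV[R]_m -> 'rV[R]_n) (A : 'M[R]_(m, n))
    (x y : 'rV[R]_m) e :
  (forall t, 0 <= t <= 1 -> differentiable f (y + t *: (x - y)) /\
     `|'J f (y + t *: (x - y)) - A| <= e) ->
  `|f x - f y - (x - y) *m A| <= m%:R * e * `|x - y|.
Proof.
move=> Hf; have e0 : 0 <= e.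
  by have [_] := Hf 0 (introT andP (conj (lexx _) ler01)); apply: le_trans.
apply: mx_norm_le => [|i j]; first by rewrite !mulr_ge0.
rewrite ord1 {i}.
pose z (t : R) := y + t *: (x - y).
pose phi (t : R) := f (z t) 0 j - t * ((x - y) *m A) 0 j.
pose dphi t := ((x - y) *m ('J f (z t) - A)) 0 j.
have dz t : differentiable z t /\ 'd z t 1 = x - y.
  have D : is_diff t z (0 + *:%R^~ (x - y)) by apply: is_diffD.
  by split; [exact: ex_diff | rewrite diff_val !fctE add0r scale1r].
have dphiE (t : R) : 0 <= t <= 1 -> is_derive t 1 phi (dphi t).
  move=> /Hf[df _]; have [dzt zt1] := dz t.
  have dfz : differentiable (f \o z) t by exact: differentiable_comp.
  have dg : is_derive t 1 (fun s => f (z s) 0 j) (((x - y) *m 'J f (z t)) 0 j).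
    apply: DeriveDef; first exact: ((derivable_mxP _ _ _).1 (diff_derivable dfz)).
    have := deriveE (1 : R) dfz.
    rewrite (derive_mx (diff_derivable dfz)) diff_comp //=.
    by rewrite zt1 /jacobian mul_rV_lin1 => <-; rewrite mxE.
  have dl (c : R) : is_derive t 1 (fun s : R => s * c) c.
    have D := is_deriveM (is_derive_id t (1 : R)) (is_derive_cst c t 1).
    by apply: is_derive_eq D _; rewrite scaler0 add0r [_ *: _]mulr1.
  rewrite /phi /dphi mulmxBr mx_subE; exact: is_deriveB.
have [c c01 E] : exists2 c, c \in `[0, 1]%R & phi 1 - phi 0 = dphi c * (1 - 0).
  apply: MVT_segment => //.
    move=> t; rewrite in_itv /= => /andP[t0 t1]; apply: dphiE.
    by rewrite !ltW.
  apply: derivable_within_continuous => t; rewrite in_itv /= => /dphiE dt.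
  exact: ex_derive.
have -> : (f x - f y - (x - y) *m A) 0 j = phi 1 - phi 0.
  have [z0 z1] : z 0 = y /\ z 1 = x by rewrite /z scale0r addr0 scale1r subrKC.
  by rewrite /phi z0 z1 mul0r subr0 mul1r !mx_subE addrAC.
rewrite E subr0 mulr1; apply: le_trans (mx_norm_entry_le _ 0 j) _.
apply: le_trans (mulmx_norm_le _ _) _.
rewrite ler_wpM2r // ler_wpM2l //.
by apply: (Hf c _).2; move: c01; rewrite in_itv.
Qed.

End Jacobian.

(* Joins completeness and norm on matrices, for the contraction principle. *)
HB.instance Definition _ (R : realType) m n := Complete.on 'M[R]_(m, n).


Section Inverse.
Context {R : realType}.

(** For a C^1 map, the linear approximation at x0 controls the increments
    between any two points near x0, with a uniform error. *)
Lemma strict_differentiability m n (U : set 'rV[R]_m)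
    (f : 'rV[R]_m -> 'rV[R]_n) x0 :
  open U -> U x0 -> Ck 1 U f -> forall e, 0 < e -> exists2 r, 0 < r &
  ball x0 r `<=` U /\ forall x y, ball x0 r x -> ball x0 r y ->
    `|f x - f y - (x - y) *m 'J f x0| <= e * `|x - y|.
Proof.
move=> oU Ux0 cf e e0.
have e'0 : 0 < e / m.+1%:R by rewrite divr_gt0.
have nU : \forall x \near x0, U x by exact: open_nbhs_nbhs.
have [r /= r0 br] := (nbhs_ballP _ _).1 (filterI nU (jacobian_near oU Ux0 cf e'0)).
exists r => //; split=> [x /br[]//|x y bx by_].
have := @mean_value_ineq R m n f ('J f x0) x y (e / m.+1%:R) _.
move=> /(_ _)/le_trans; apply.
  move=> t /andP[t0 t1].
  have /br[Uz Hz] : ball x0 r (y + t *: (x - y)).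
    move: bx by_; rewrite -ball_normE /= => bx by_.
    have -> : x0 - (y + t *: (x - y)) = t *: (x0 - x) + (1 - t) *: (x0 - y).
      by apply/rowP => j; rewrite !mxE; lra.
    apply: le_lt_trans (ler_normD _ _) _; rewrite !normrZ !ger0_norm ?subr_ge0 //.
    have [->|tn0] := eqVneq t 0; first by rewrite mul0r add0r subr0 mul1r.
    have tp : 0 < t by rewrite lt_neqAle eq_sym tn0.
    rewrite -[ltRHS](_ : t * r + (1 - t) * r = r); last by lra.
    by rewrite ltr_leD // ?ltr_pM2l // ler_wpM2l ?subr_ge0 // ltW.
  by split=> //; exact: (Ck_differentiable cf).
rewrite ler_wpM2r // mulrCA ger_pMr // ler_pdivrMr // mul1r ler_nat.
exact: leqnSn.
Qed.

(** With a right inverse B of the Jacobian at x0, x - y is close to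
    (f x - f y) B; the error is absorbed in the left-hand side.  The same
    absorption shows that the kernel of a nearby Jacobian is trivial. *)
Lemma local_immersion m n (U : set 'rV[R]_m) (f : 'rV[R]_m -> 'rV[R]_n) x0 :
  open U -> U x0 -> Ck 1 U f -> row_free ('J f x0) ->
  exists r C, [/\ 0 < r, 0 < C, ball x0 r `<=` U,
    forall x y, ball x0 r x -> ball x0 r y -> `|x - y| <= C * `|f x - f y|
    & forall x, ball x0 r x -> row_free ('J f x)].
Proof.
move=> oU Ux0 cf; pose A := 'J f x0; have AE : 'J f x0 = A by [].
clearbody A; rewrite AE => free0.
have AB := mulmxVp free0; set B := pinvmx A in AB.
(* A bound for the operator norm of B, kept positive by the summand 1. *)
pose K : R := n%:R * `|B| + 1.
have K0 : 0 < K by rewrite ltr_wpDl // mulr_ge0.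
have KB (v : 'rV[R]_n) : `|v *m B| <= K * `|v|.
  by apply: le_trans (mulmx_norm_le _ _) _; rewrite ler_wpM2r // lerDl.
have e0 : 0 < (2 * K)^-1 by rewrite invr_gt0 mulr_gt0.
have [r1 r10 [r1U strict]] := strict_differentiability oU Ux0 cf e0.
rewrite AE in strict.
have e'0 : 0 < (2 * K * m.+1%:R)^-1 by rewrite invr_gt0 !mulr_gt0.
have [r2 /= r20 near_J] := (nbhs_ballP _ _).1 (jacobian_near oU Ux0 cf e'0).
rewrite AE in near_J.
have br x : ball x0 (Num.min r1 r2) x -> ball x0 r1 x /\ ball x0 r2 x.
  by move=> bx; split; apply: le_ball bx; rewrite ge_min lexx ?orbT.
exists (Num.min r1 r2), (2 * K); split.
- by rewrite lt_min r10.
- by rewrite mulr_gt0.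
- by move=> x /br[/r1U].
- move=> x y /br[bx _] /br[by_ _].
  have {strict} := strict x y bx by_.
  set D := f x - f y; set h := x - y => strict.
  have hE : h = D *m B - (D - h *m A) *m B.
    by rewrite [(_ - h *m A) *m B]mulmxBl opprB addrC subrK -mulmxA AB mulmx1.
  have : `|h| <= K * `|D| + K * ((2 * K)^-1 * `|h|).
    rewrite {1}hE (le_trans (ler_normB _ _)) // lerD //.
    by apply: le_trans (KB _) _; rewrite ler_wpM2l // ltW.
  have -> : K * ((2 * K)^-1 * `|h|) = `|h| / 2 by field; rewrite gt_eqF.
  lra.
- move=> x /br[_ /near_J /=]; move: ('J f x) => M nM.
  apply: row_free_of_ker => v vM.
  have vE : v = - (v *m (M - A) *m B).
    by rewrite mulmxBr vM sub0r mulNmx opprK -mulmxA AB mulmx1.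
  have : `|v| <= K * (m%:R * (2 * K * m.+1%:R)^-1 * `|v|).
    rewrite {1}vE normrN (le_trans (KB _)) // ler_wpM2l ?(ltW K0) //.
    apply: le_trans (mulmx_norm_le _ _) _.
    by rewrite ler_wpM2r // ler_wpM2l.
  have -> : K * (m%:R * (2 * K * m.+1%:R)^-1 * `|v|) =
    m%:R / m.+1%:R * (`|v| / 2) by field; rewrite ?gt_eqF //= .
  have m1 : m%:R / m.+1%:R <= 1 :> R by rewrite ler_pdivrMr // mul1r ler_nat.
  have v2 : 0 <= `|v| / 2 by rewrite divr_ge0.
  move=> /le_trans/(_ (ler_wpM2r v2 m1)) H.
  by apply/eqP; rewrite -normr_le0; move: H; lra.
Qed.

Lemma jacobian_of_eps m n (f : 'rV[R]_m -> 'rV[R]_n) (B : 'M[R]_(m, n)) y :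
  (forall e, 0 < e ->
    \forall z \near y, `|f z - f y - (z - y) *m B| <= e * `|z - y|) ->
  differentiable f y /\ 'J f y = B.
Proof.
move=> /(differentiable_of_eps (L := mulmxr B) (@mulmxr_continuous _ _ _ B))[df dE].
split=> //; apply/row_matrixP => i.
by rewrite jacobian_row // deriveE // dE /= -rowE.
Qed.

(** Solving f x = y is a fixed-point problem for the simplified Newton map
    x |-> x - (f x - y) A^-1, A being the Jacobian at x0: strict
    differentiability makes it a contraction of a small ball.  The inverse is
    Lipschitz by [local_immersion], which turns the linear approximation of f
    into one of the inverse.  Smoothness follows by induction on k from
    'J g = ('J f o g)^-1. *)
Theorem inverse_function n (U : set 'rV[R]_n) (f : 'rV[R]_n -> 'rV[R]_n) x0 :
  open U -> U x0 -> smooth_on U f -> 'J f x0 \in unitmx ->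
  exists r V (g : 'rV[R]_n -> 'rV[R]_n),
    [/\ 0 < r, ball x0 r `<=` U, open V & V (f x0)] /\
    [/\ forall y, V y -> ball x0 r (g y) /\ f (g y) = y,
       forall x, ball x0 r x -> V (f x) -> g (f x) = x,
       forall y, V y -> 'J g y = invmx ('J f (g y))
     & smooth_on V g].
Proof.
move=> oU Ux0 sf; pose A := 'J f x0; have AE : 'J f x0 = A by [].
clearbody A; rewrite AE => u0.
have f1 := sf 1%N.
pose K : R := n%:R * `|invmx A| + 1.
have K0 : 0 < K by rewrite ltr_wpDl // mulr_ge0.
have KB (v : 'rV[R]_n) : `|v *m invmx A| <= K * `|v|.
  by apply: le_trans (mulmx_norm_le _ _) _; rewrite ler_wpM2r // lerDl.
have free0 : row_free ('J f x0) by rewrite AE row_free_unit.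
have [r1 [C [r10 C0 r1U lip free]]] := local_immersion oU Ux0 f1 free0.
have e0 : 0 < (2 * K)^-1 by rewrite invr_gt0 mulr_gt0.
have [r2 r20 [_ strict]] := strict_differentiability oU Ux0 f1 e0.
rewrite AE in strict.
pose r := Num.min r1 r2.
have r0 : 0 < r by rewrite lt_min r10.
have br x : ball x0 r x -> ball x0 r1 x /\ ball x0 r2 x.
  by move=> bx; split; apply: le_ball bx; rewrite ge_min lexx ?orbT.
(* The radius makes the Newton map move x0 by at most r / 4; with contraction
   factor 1/2 the closed ball of radius r / 2 is then mapped into itself. *)
pose V := ball (f x0) (r / (4 * K)).
have solve y : V y -> exists2 x, ball x0 r x & f x = y.
  move=> Vy; pose T x := x - (f x - y) *m invmx A.
  pose B := closed_ball x0 (r / 2).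
  have BE x : B x = (`|x0 - x| <= r / 2) by rewrite /B closed_ballE ?divr_gt0.
  have Br x : B x -> ball x0 r x.
    rewrite BE -ball_normE /=; move/le_lt_trans; apply; lra.
  have Tlip x x' : B x -> B x' -> `|T x - T x'| <= 2^-1 * `|x - x'|.
    move=> /Br/br[_ bx] /Br/br[_ bx'].
    have -> : T x - T x' = - ((f x - f x' - (x - x') *m A) *m invmx A).
      rewrite mulmxBl mulmxK // opprB /T.
      rewrite !mulmxBl.
      move: (f x *m invmx A) (f x' *m invmx A) (y *m invmx A) => a b c.
      by apply/rowP => j; rewrite !mxE; lra.
    rewrite normrN (le_trans (KB _)) //.
    rewrite (le_trans (ler_wpM2l (ltW K0) (strict _ _ bx bx'))) //.
    by rewrite invfM mulrA (mulrC _ K^-1) mulrA divff ?gt_eqF // mul1r.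
  have Bx0 : B x0 by rewrite BE subrr normr0 divr_ge0 // ltW.
  have TB : set_fun B B T.
    move=> x Bx; have := Tlip _ _ Bx Bx0.
    have : `|T x0 - x0| <= r / 4.
      rewrite /T addrC addKr normrN (le_trans (KB _)) //.
      move: Vy; rewrite /V -ball_normE /= => /ltW.
      rewrite [r / 4](_ : _ = K * (r / (4 * K))); last by field; rewrite gt_eqF.
      by rewrite ler_pM2l.
    move: Bx; rewrite !BE => Bx H1 H2.
    rewrite distrC in Bx; rewrite distrC -(subrKA (T x0)).
    rewrite (le_trans (ler_normD _ _)) //; lra.
  pose TF : {fun B >-> B} := mkfun_fun TB.
  have ctr : is_contraction TF.
    exists (2^-1)%:nng; split=> /=; first by lra.
    by move=> [x x'] [/= Bx Bx']; exact: Tlip.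
  have [] := banach_fixed_point ctr (@closed_ball_closed _ _ _ _).
    by exists x0.
  move=> x Bx /= Tx; exists x; first exact: Br.
  apply/eqP; rewrite -subr_eq0; apply/eqP.
  have : (f x - y) *m invmx A = 0.
    have /eqP : x = x - (f x - y) *m invmx A := Tx.
    by rewrite -subr_eq0 opprB addrC subrK => /eqP.
  by move=> /(congr1 (mulmxr A)) /=; rewrite mulmxKV // mul0mx.
have /choice[g gP] : forall y, exists x, V y -> ball x0 r x /\ f x = y.
  move=> y; have [Vy|nVy] := pselect (V y); last by exists x0.
  by have [x bx fx] := solve y Vy; exists x.
have oV : open V by exact: ball_open.
have gW y : V y -> ball x0 r (g y) by move=> /gP[].
have fg y : V y -> f (g y) = y by move=> /gP[].
have glip y z : V y -> V z -> `|g y - g z| <= C * `|y - z|.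
  move=> Vy Vz; rewrite -{2}(fg y Vy) -{2}(fg z Vz); apply: lip.
    exact: (br _ (gW y Vy)).1.
  exact: (br _ (gW z Vz)).1.
have gU y : V y -> U (g y) by move=> /gW/br[/r1U].
have nV y : V y -> \forall z \near y, V z by move=> Vy; exact: open_nbhs_nbhs.
have cg y : V y -> {for y, continuous g}.
  move=> Vy; apply/(@cvgrPdist_le _ _ _ (nbhs y)) => e e_gt0.
  have eC : 0 < e / C by rewrite divr_gt0.
  have near_y : \forall z \near y, `|y - z| <= e / C.
    by apply: (@cvgr_dist_le _ _ _ (nbhs y) _ id y); first exact: cvg_id.
  apply: filterS2 (nV y Vy) near_y => z Vz; rewrite ler_pdivlMr // mulrC.
  exact: le_trans (glip _ _ Vy Vz).
have uJ y : V y -> 'J f (g y) \in unitmx.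
  by move=> /gW/br[/free]; rewrite row_free_unit.
have dg y : V y -> differentiable g y /\ 'J g y = invmx ('J f (g y)).
  move=> Vy; apply: jacobian_of_eps => e e_gt0.
  have dfgy : differentiable f (g y) := Ck_differentiable f1 (gU y Vy).
  have dfE h : 'd f (g y) h = h *m 'J f (g y).
    by rewrite -deriveE // deriveEjacobian.
  move: (uJ y Vy) dfE; move: ('J f (g y)) => J uJy dfE.
  pose L : R := n%:R * `|invmx J| + 1.
  have L0 : 0 < L by rewrite ltr_wpDl // mulr_ge0.
  have eLC : 0 < e / (L * C) by rewrite divr_gt0 // mulr_gt0.
  have near_f : \forall z \near y,
      `|f (g z) - f (g y) - 'd f (g y) (g z - g y)| <=
        e / (L * C) * `|g z - g y|.
    exact: cg y Vy _ (differentiable_eps dfgy eLC).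
  apply: filterS2 (nV y Vy) near_f => z Vz.
  rewrite dfE !fg // => H.
  have -> : g z - g y - (z - y) *m invmx J =
      - ((z - y - (g z - g y) *m J) *m invmx J).
    by rewrite [(_ - _ *m J) *m _]mulmxBl mulmxK // opprB.
  rewrite normrN (le_trans (mulmx_norm_le _ _)) //.
  rewrite (@le_trans _ _ (L * (e / (L * C) * (C * `|z - y|)))) //.
    rewrite ler_pM ?mulr_ge0 ?lerDl // (le_trans H) // ler_wpM2l ?(ltW eLC) //.
    exact: glip.
  rewrite le_eqVlt; apply/orP; left; apply/eqP; field.
  by rewrite !gt_eqF.
exists r, V, g; split.
  split=> //; first by move=> x /br[/r1U].
  by apply: ballxx; rewrite divr_gt0 // mulr_gt0.
split=> //.
- by move=> x bx Vfx; have [/br[b1 _] E] := gP _ Vfx;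
    apply/eqP; rewrite -subr_eq0 -normr_le0;
    apply: le_trans (lip _ _ b1 (br _ bx).1) _; rewrite E subrr normr0 mulr0.
- by move=> y /dg[].
elim=> [|k IH]; first by move=> y Vy; exact: cg.
split=> [y /dg[]//|h].
apply: (coord_Ck oV) => j.
have cJ a b : Ck k V (fun y => 'J f (g y) a b).
  have [_ /(_ (delta_mx 0 a))] := sf k.+1.
  move=> /(Ck_coord oU 0 b) /(Ck_comp oV oU gU IH); apply: (Ck_ext oV) => y Vy.
  by apply/esym/jacobianE/(Ck_differentiable f1)/gU.
have := @Ck_sum _ _ _ oV _ k _ (index_enum 'I_n) predT
  (fun i y => h 0 i * invmx ('J f (g y)) i j)
  (fun i _ => Ck_M oV (Ck_cst oV k (h 0 i)) (Ck_invmx oV uJ cJ i j)).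
apply: (Ck_ext oV) => y Vy; have [dgy Jg] := dg y Vy.
by rewrite [RHS](_ : _ = (h *m 'J g y) 0 j) ?deriveEjacobian // Jg mxE.
Qed.

End Inverse.

(** * Metric orthogonality and transversality *)

Section LinearAlgebra.
Context {R : realType}.

Lemma positive_definite_unit n (A : 'M[R]_n) : positive_definite A -> A \in unitmx.
Proof.
move=> Apos; rewrite -row_free_unit; apply: row_free_of_ker => v vA.
by apply/eqP; apply: contraT => /Apos; rewrite vA mul0mx mxE ltxx.
Qed.

(** Substituting x = y A turns x A^-1 x^T into y A^T y^T, which is the number
    y A y^T. *)
Lemma positive_definite_inv n (A : 'M[R]_n) :
  positive_definite A -> positive_definite (invmx A).
Proof.
move=> Apos x x0; have uA := positive_definite_unit Apos.
have := Apos (x *m invmx A) _; rewrite mulmxKV // trmx_mul mulmxA.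
have -> : x *m (invmx A)^T *m x^T = (x *m invmx A *m x^T)^T.
  by rewrite !trmx_mul trmxK mulmxA.
rewrite [(_^T) _ _]mxE; apply; apply: contra x0 => /eqP/(congr1 (mulmxr A)) /=.
by rewrite mulmxKV // mul0mx => /eqP.
Qed.

(** The row space of E is an orthogonal complement, and it contains the columns
    of M J^T, because these are orthogonal to ker (M J^T).  So what E
    annihilates, M J^T annihilates as well. *)
Lemma double_orth_annihilator m d p (M : 'M[R]_d) (J : 'M[R]_(p, d))
    (E : 'M[R]_(m, d)) (w : 'rV[R]_d) :
  (E :=: orth 1%:M (orth M J))%MS -> w *m E^T = 0 -> w *m M *m J^T = 0.
Proof.
rewrite /orth mul1mx => EE wE.
have : ((M *m J^T)^T <= E)%MS.
  by rewrite EE; apply/sub_kermxP; rewrite -trmx_mul mulmx_ker trmx0.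
case/submxP => D /(congr1 trmx); rewrite trmxK trmx_mul => SE.
by rewrite -mulmxA SE mulmxA wE mul0mx.
Qed.

(** If a J is annihilated by E, then it is M-orthogonal to the row space of J,
    hence to itself. *)
Lemma transversality d p (M : 'M[R]_d) (J E : 'M[R]_(p, d)) :
  positive_definite M -> row_free J -> (E :=: orth 1%:M (orth M J))%MS ->
  J *m E^T \in unitmx.
Proof.
move=> Mpos freeJ EE; rewrite -row_free_unit; apply: row_free_of_ker => a.
rewrite mulmxA => /(double_orth_annihilator EE) aJ.
have aJ0 : a *m J = 0.
  apply/eqP; apply: contraT => /Mpos; rewrite trmx_mul mulmxA aJ mul0mx.
  by rewrite mxE ltxx.
by apply: (row_free_inj freeJ); rewrite aJ0 mul0mx.
Qed.

End LinearAlgebra.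

(** * Coordinates adapted to the leaves of the estimating equations *)

Section Leaves.
Context {R : realType} {d p : nat}.
Variables (U0 : set 'rV[R]_p) (eta0 : 'rV[R]_p -> 'rV[R]_d).
Variable slope : 'rV[R]_p -> 'rV[R]_d -> 'M[R]_(p, d).
Hypothesis openU0 : open U0.
Hypothesis smooth_eta0 : smooth_on U0 eta0.

Let Omega : set 'rV[R]_(p + d) := [set z | U0 (lsubmx z)].
Hypothesis smooth_slope : forall k i j,
  Ck k Omega (fun z => slope (lsubmx z) (rsubmx z) i j).

(** For fixed u, the zeros of [leaf_eq u] form the leaf of X with estimate u.
    At X = eta0 u its differential is right multiplication by
    (slope u (eta0 u))^T. *)
Definition leaf_eq (u : 'rV[R]_p) (X : 'rV[R]_d) : 'rV[R]_p :=
  (X - eta0 u) *m (slope u X)^T.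

Lemma open_lsub n : open [set z : 'rV[R]_(p + n) | U0 (lsubmx z)].
Proof. by apply: open_comp openU0 => z _; exact: continuous_lsubmx. Qed.

Lemma Ck_lsub k n (U : set 'rV[R]_(p + n)) : open U -> Ck k U lsubmx.
Proof.
move=> oU; apply: (@Ck_linear _ _ U oU _ _ k lsubmx id); last exact: Ck_id.
by move=> z; exact: continuous_lsubmx.
Qed.

Lemma Ck_rsub k m n (U : set 'rV[R]_(m + n)) : open U -> Ck k U rsubmx.
Proof.
move=> oU; apply: (@Ck_linear _ _ U oU _ _ k rsubmx id); last exact: Ck_id.
by move=> z; exact: continuous_rsubmx.
Qed.

Lemma smooth_eta0_lsub k n :
  Ck k [set z : 'rV[R]_(p + n) | U0 (lsubmx z)] (fun z => eta0 (lsubmx z)).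
Proof.
apply: (coord_Ck (@open_lsub n)) => j.
exact: (Ck_comp (f := fun u => eta0 u 0 j) (@open_lsub n) openU0 (fun _ => id)
  (Ck_lsub _ (@open_lsub n)) (Ck_coord openU0 0 j (smooth_eta0 k))).
Qed.

Lemma derive_eta0_lsub n (z h : 'rV[R]_(p + n)) : U0 (lsubmx z) ->
  is_derive z h (fun y => eta0 (lsubmx y)) (lsubmx h *m 'J eta0 (lsubmx z)).
Proof.
move=> Uz; have dl : differentiable lsubmx z := differentiable_lsubmx _.
have de := Ck_differentiable (smooth_eta0 1) Uz.
have cl : continuous (lsubmx : 'rV[R]_(p + n) -> _).
  by move=> ?; exact: continuous_lsubmx.
apply: is_derive_eq (is_derive_comp h dl de) _.
rewrite -deriveE // deriveEjacobian //.
by rewrite (derive_val (is_derive := is_derive_linear z h cl)).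
Qed.

Section Efficiency.
Variables (W : set 'rV[R]_(p + (d - p))) (eta : 'rV[R]_(p + (d - p)) -> 'rV[R]_d).
Hypothesis openW : open W.
Hypothesis WU0 : forall w, W w -> U0 (lsubmx w).
Hypothesis smooth_eta : smooth_on W eta.
Hypothesis leaf : forall w, W w -> leaf_eq (lsubmx w) (eta w) = 0.

(** A leaf is tangent at eta0 u to the kernel of its linear part: in the product
    rule, the derivative of the slope is multiplied by eta - eta0 u, which is
    zero there. *)
Lemma leaf_tangent u h : W (row_mx u 0) -> eta (row_mx u 0) = eta0 u ->
  lsubmx h = 0 -> 'D_h eta (row_mx u 0) *m (slope u (eta0 u))^T = 0.
Proof.
move=> Wu etau h0; set w := row_mx u 0 in Wu etau *.
have wl : lsubmx w = u by rewrite row_mxKl.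
pose Y w' := eta w' - eta0 (lsubmx w').
pose S w' := (slope (lsubmx w') (eta w'))^T.
have deta : differentiable eta w := Ck_differentiable (smooth_eta 1) Wu.
have dY : is_derive w h Y ('D_h eta w).
  apply: is_derive_eq (is_deriveB (derivableP (diff_derivable deta))
    (derive_eta0_lsub h (WU0 Wu))) _.
  by rewrite h0 mul0mx subr0.
have cS i j : Ck 1 W (fun w' => S w' i j).
  pose pair w' := row_mx (lsubmx w') (eta w').
  have cpair : Ck 1 W pair.
    by apply: (Ck_row_mx openW) (smooth_eta 1); exact: Ck_lsub.
  have pairO x : W x -> Omega (pair x) by move=> /WU0; rewrite /Omega /= row_mxKl.
  apply: (Ck_ext openW)
    (Ck_comp openW (@open_lsub d) pairO cpair (smooth_slope 1 j i)).
  by move=> x _; rewrite /S mxE row_mxKl row_mxKr.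
have dS : derivable S w h.
  apply/derivable_mxP => i j; apply: diff_derivable.
  exact: Ck_differentiable (cS i j) Wu.
have D := is_derive_mulmx dY (derivableP dS).
have Y0 : Y w = 0 by rewrite /Y wl etau subrr.
move: D; rewrite Y0 mul0mx addr0 /S wl etau => D.
rewrite -(derive_val (is_derive := D)).
rewrite -[RHS](derive_cst (0 : 'rV[R]_p) w h).
apply: near_eq_derive; apply: filterS (open_nbhs_nbhs (conj openW Wu)) => w' Ww'.
exact: leaf.
Qed.

End Efficiency.

Section Existence.
Variable ustar : 'rV[R]_p.
Hypothesis Ustar : U0 ustar.
Let J := 'J eta0 ustar.
Let E := slope ustar (eta0 ustar).
Hypothesis transversal : J *m E^T \in unitmx.
Let zstar := row_mx ustar (eta0 ustar).

Lemma slope_free : row_free E.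
Proof.
apply: row_free_of_ker => v vE; apply/(row_free_inj (A := (J *m E^T)^T)) => //.
  by rewrite row_free_unit unitmx_tr.
by rewrite trmx_mul trmxK mulmxA vE !mul0mx.
Qed.

(* A left inverse of E^T, which carries the correction of the slope. *)
Let Q := (pinvmx E)^T.
Let QE : Q *m E^T = 1%:M.
Proof. by rewrite -trmx_mul mulmxVp ?trmx1 // slope_free. Qed.

Let Y (z : 'rV[R]_(p + d)) := rsubmx z - eta0 (lsubmx z).
Let B (z : 'rV[R]_(p + d)) :=
  1%:M + (slope (lsubmx z) (rsubmx z) - E)^T *m Q.

(** A local chart in which the leaves become affine.  The factor B equals 1 at
    the centre, so that the derivative there is invertible, and the second
    component times E^T is the equation of the leaf: it lies in ker E^T exactly
    on the leaf. *)
Definition straighten (z : 'rV[R]_(p + d)) := row_mx (lsubmx z) (Y z *m B z).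

Lemma straighten_leaf z : Y z *m B z *m E^T = leaf_eq (lsubmx z) (rsubmx z).
Proof.
rewrite -mulmxA /B mulmxDl mul1mx -mulmxA QE mulmx1.
by rewrite linearB /= addrC subrK.
Qed.

Let openO : open Omega := @open_lsub d.

Let cB k i j : Ck k Omega (fun z => B z i j).
Proof.
have cN a b : Ck k Omega (fun z => (slope (lsubmx z) (rsubmx z) - E)^T a b).
  apply: (Ck_ext openO)
    (Ck_D openO (smooth_slope k b a) (Ck_cst openO k (- E b a))).
  by move=> z _; rewrite !mxE.
have cQ a b : Ck k Omega (fun=> Q a b) by exact: Ck_cst.
have := Ck_D openO (Ck_cst openO k ((1%:M : 'M[R]_d) i j))
  (Ck_mulmx openO cN cQ i j).
by apply: (Ck_ext openO) => z _; rewrite [RHS]mxE.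
Qed.

Let cY k : Ck k Omega Y.
Proof.
apply: (Ck_D openO); first exact: Ck_rsub.
apply: (coord_Ck openO) => j.
have := Ck_M openO (Ck_cst openO k (-1 : R))
  (Ck_coord openO 0 j (@smooth_eta0_lsub k d)).
by apply: (Ck_ext openO) => z _; rewrite mulN1r mxE.
Qed.

Lemma smooth_straighten : smooth_on Omega straighten.
Proof.
move=> k; apply: (Ck_row_mx openO); first exact: Ck_lsub.
apply: (coord_Ck openO) => j; apply: (Ck_mulmx openO) => [a b|a b]; last exact: cB.
exact: Ck_coord.
Qed.

Lemma zstar_in : Omega zstar.
Proof. by rewrite /Omega /= row_mxKl. Qed.

Lemma straighten_center u : straighten (row_mx u (eta0 u)) = row_mx u 0.
Proof. by rewrite /straighten /Y row_mxKl row_mxKr subrr mul0mx. Qed.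

(** At the centre Y = 0 and B = 1, so Y B has the derivative of Y there. *)
Lemma jacobian_straighten (h : 'rV[R]_(p + d)) :
  h *m 'J straighten zstar = row_mx (lsubmx h) (rsubmx h - lsubmx h *m J).
Proof.
have dT : differentiable straighten zstar.
  exact: Ck_differentiable (smooth_straighten 1) zstar_in.
rewrite -deriveEjacobian //.
have cr : continuous (rsubmx : 'rV[R]_(p + d) -> _).
  by move=> ?; exact: continuous_rsubmx.
have dK : is_derive zstar h (fun z => Y z *m B z) (rsubmx h - lsubmx h *m J).
  have Ul : U0 (lsubmx zstar) := zstar_in.
  have dY : is_derive zstar h Y (rsubmx h - lsubmx h *m J).
    apply: is_derive_eq (is_deriveB (is_derive_linear zstar h cr)
      (derive_eta0_lsub h Ul)) _.
    by rewrite row_mxKl.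
  have dB : derivable B zstar h.
    apply/derivable_mxP => i j; apply: diff_derivable.
    exact: Ck_differentiable (cB 1 i j) zstar_in.
  apply: is_derive_eq (is_derive_mulmx dY (derivableP dB)) _.
  rewrite /B /Y row_mxKl row_mxKr !subrr trmx0 !mul0mx !addr0 mulmx1 //.
have cl : continuous (lsubmx : 'rV[R]_(p + d) -> _).
  by move=> ?; exact: continuous_lsubmx.
have dl := is_derive_linear zstar h cl.
rewrite -[LHS]hsubmxK; congr row_mx.
- have fE : (fun z => lsubmx (straighten z)) = lsubmx.
    by apply/funext => z; rewrite row_mxKl.
  have := is_derive_linear_comp h cl dT; rewrite fE => D.
  exact: is_derive_unique D dl.
- have fE : (fun z => rsubmx (straighten z)) = (fun z => Y z *m B z).
    by apply/funext => z; rewrite row_mxKr.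
  have := is_derive_linear_comp h cr dT; rewrite fE => D.
  exact: is_derive_unique D dK.
Qed.

Lemma jacobian_straighten_unit : 'J straighten zstar \in unitmx.
Proof.
rewrite -row_free_unit; apply: row_free_of_ker => v; rewrite jacobian_straighten.
rewrite -[0]row_mx0 => /eq_row_mx[v1]; rewrite v1 mul0mx subr0 => v2.
by rewrite -[v]hsubmxK v1 v2 row_mx0.
Qed.

Hypothesis ltpd : (p < d)%N.

Lemma leaf_directions : exists2 N : 'M[R]_(d - p, d), row_free N & N *m E^T = 0.
Proof.
have rE : \rank (kermx E^T) = (d - p)%N.
  by rewrite mxrank_ker mxrank_tr (eqP slope_free).
case: _ / rE; exists (row_base (kermx E^T)); first exact: row_base_free.
by apply/sub_kermxP; rewrite eq_row_base.
Qed.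

(** Pull back the coordinates (u, v N) of the straightened picture, where the
    rows of N form a basis of ker E^T.  The model corresponds to v = 0.  At the
    centre a vector (a, b) in the kernel of the Jacobian of the coordinates
    satisfies a J + b N = 0; multiplying by E^T kills b N and gives a = 0 by
    transversality, then b = 0. *)
Lemma leaf_coordinates : exists W eta,
  estimator U0 ustar eta0 W eta /\
  forall w, W w -> leaf_eq (lsubmx w) (eta w) = 0.
Proof.
have [N freeN NE] := leaf_directions.
have [r [V [g [[r0 brO oV Vz] [gP gK Jg sg]]]]] :=
  inverse_function openO zstar_in smooth_straighten jacobian_straighten_unit.
pose I : 'M[R]_(p + (d - p), p + d) := block_mx 1%:M 0 0 N.
have IE w : w *m I = row_mx (lsubmx w) (rsubmx w *m N).
  by rewrite -[w in LHS]hsubmxK mul_row_block !mulmx0 mulmx1 addr0 add0r.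
have cI : continuous (mulmxr I : 'rV[R]_(p + (d - p)) -> _).
  exact: mulmxr_continuous.
pose W0 := [set w | V (w *m I)].
have oW0 : open W0 by apply: open_comp oV => w _; exact: cI.
pose eta (w : 'rV[R]_(p + (d - p))) : 'rV[R]_d := rsubmx (g (w *m I)).
have gE w : W0 w -> [/\ U0 (lsubmx w), g (w *m I) = row_mx (lsubmx w) (eta w)
    & leaf_eq (lsubmx w) (eta w) = 0].
  move=> W0w; have [/brO Og gw] := gP _ W0w.
  have [gl gr] : lsubmx (g (w *m I)) = lsubmx w /\
     Y (g (w *m I)) *m B (g (w *m I)) = rsubmx w *m N.
    by apply: eq_row_mx; rewrite -IE -[RHS]gw.
  split; [by rewrite -gl | by rewrite -gl hsubmxK |].
  by rewrite -gl -straighten_leaf gr -mulmxA NE mulmx0.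
have seta : smooth_on W0 eta.
  move=> k; apply: (coord_Ck oW0) => j.
  have cIk : Ck k W0 (fun w => w *m I).
    exact: (@Ck_linear _ _ _ oW0 _ _ k (mulmxr I) id cI (Ck_id oW0 k)).
  have cgj : Ck k V (fun z => rsubmx (g z) 0 j).
    apply: (Ck_ext oV) (Ck_coord oV 0 (rshift p j) (sg k)) => z _.
    by rewrite mxE.
  exact: (Ck_comp (f := fun z => rsubmx (g z) 0 j) oW0 oV (fun _ => id) cIk cgj).
pose wstar : 'rV[R]_(p + (d - p)) := row_mx ustar 0.
have wI u : row_mx u 0 *m I = row_mx u 0 by rewrite IE row_mxKl row_mxKr mul0mx.
have W0star : W0 wstar by rewrite /W0 /= wI -straighten_center.
have etaE u : W0 (row_mx u 0) -> ball zstar r (row_mx u (eta0 u)) ->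
    eta (row_mx u 0) = eta0 u.
  rewrite /W0 /eta /= wI -straighten_center => Vu bu.
  by rewrite (gK _ bu Vu) row_mxKr.
have freeJ : row_free ('J eta wstar).
  have deta : differentiable eta wstar := Ck_differentiable (seta 1) W0star.
  apply: row_free_of_ker => v; rewrite -deriveEjacobian // => Dv.
  have dg : differentiable g (wstar *m I) := Ck_differentiable (sg 1) W0star.
  have dI : differentiable (mulmxr I : 'rV[R]_(p + (d - p)) -> _) wstar.
    exact: linear_differentiable.
  pose t := v *m I *m 'J g (wstar *m I).
  have t0 : rsubmx t = 0.
    have dgI : differentiable (fun w => g (w *m I)) wstar.
      exact: differentiable_comp dI dg.
    have cr : continuous (rsubmx : 'rV[R]_(p + d) -> _).
      by move=> ?; exact: continuous_rsubmx.
    have D2 := is_derive_linear_comp v cr dgI.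
    have D1 := is_derive_comp v dI dg.
    move: Dv; rewrite (derive_val (is_derive := D2)) (derive_val (is_derive := D1)).
    rewrite -deriveE // deriveEjacobian //.
    by rewrite (derive_val (is_derive := is_derive_linear wstar v cI)).
  have gstar : g (wstar *m I) = zstar.
    by rewrite wI -straighten_center; apply: gK => //; exact: ballxx.
  have tI : t *m 'J straighten zstar = v *m I.
    by rewrite /t Jg // gstar mulmxKV // jacobian_straighten_unit.
  move: tI; rewrite jacobian_straighten t0 sub0r IE => /eq_row_mx[tl tr].
  have l0 : lsubmx t = 0.
    apply: (row_free_inj (A := J *m E^T)); first by rewrite row_free_unit.
    rewrite mul0mx mulmxA -[lsubmx t *m J]opprK tr mulNmx -mulmxA NE.
    by rewrite mulmx0 oppr0.
  rewrite -[v]hsubmxK -tl l0; move: tr; rewrite l0 mul0mx oppr0 => vN.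
  suff -> : rsubmx v = 0 by rewrite row_mx0.
  by apply: (row_free_inj freeN); rewrite mul0mx.
have [r1 [C [r10 C0 br1 lip free]]] := local_immersion oW0 W0star (seta 1) freeJ.
(* On W1 the point (u, eta0 u) lies in the ball where g is a left inverse,
   which forces eta (u, 0) = eta0 u. *)
pose W1 := [set w : 'rV[R]_(p + (d - p)) | U0 (lsubmx w) /\
  ball zstar r (row_mx (lsubmx w) (eta0 (lsubmx w)))].
have nW1 : \forall w \near wstar, W1 w.
  have oU1 := @open_lsub (d - p).
  have Uw : U0 (lsubmx wstar) by rewrite row_mxKl.
  have := Ck_row_mx oU1 (Ck_lsub 0 oU1) (@smooth_eta0_lsub 0 (d - p)).
  move=> /(_ wstar Uw); rewrite /prop_for /continuous_at /= row_mxKl => cq.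
  have near_ball := cq _ (nbhsx_ballx zstar r r0).
  exact: filterI (open_nbhs_nbhs (conj oU1 Uw)) near_ball.
have [r2 /= r20 br2] := (nbhs_ballP _ _).1 nW1.
exists (ball wstar (Num.min r1 r2)), eta.
have b12 w : ball wstar (Num.min r1 r2) w -> ball wstar r1 w /\ ball wstar r2 w.
  by move=> bw; split; apply: le_ball bw; rewrite ge_min lexx ?orbT.
split; last by move=> w /b12[/br1/gE[]].
split.
- exact: ball_open.
- by apply: ballxx; rewrite lt_min r10.
- by move=> k; apply: Ck_subset (seta k) => w /b12[/br1].
- move=> w w' /b12[bw _] /b12[bw' _] ee; apply/eqP.
  rewrite -subr_eq0 -normr_le0; apply: le_trans (lip _ _ bw bw') _.
  by rewrite ee subrr normr0 mulr0.
- by move=> w /b12[/free/eqP-> _]; rewrite subnKC // ltnW.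
- by move=> u v /b12[/br1/gE[+ _ _] _]; rewrite row_mxKl.
- move=> u /b12[/br1 W0u /br2[]]; rewrite row_mxKl => _; exact: etaE.
Qed.

End Existence.

End Leaves.

(** * First-order efficiency of the estimating equations *)

Unset Implicit Arguments.
Set Strict Implicit.

Theorem theorem6 (R : realType) (d p : nat) (lt_pd : (p < d)%N)
  (nu : {measure set (borel_space R d) -> \bar R})
  (Theta : set 'rV[R]_d) (psi : 'rV[R]_d -> R)
  (family : exponential_family nu Theta psi)
  (H : set 'rV[R]_d) (th : 'rV[R]_d -> 'rV[R]_d)
  (inverse : local_inverse Theta psi H th)
  (VE : set 'rV[R]_d) (U0 : set 'rV[R]_p) (ustar : 'rV[R]_p)
  (eta0 : 'rV[R]_p -> 'rV[R]_d)
  (param : regular_parametrization VE U0 ustar eta0)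
  (param_dom : forall u, U0 u -> H (eta0 u))
  (algebraic : algebraic_curved_family p Theta psi VE (th (eta0 ustar)))
  (u_poly : exists P : 'I_p -> mpoly d R,
     forall u, U0 u -> forall a, u 0 a = peval (P a) (eta0 u))
  (e : 'I_p -> 'I_d -> mpoly d R)
  (e_span : forall u, U0 u ->
     (\matrix_(i < p, j < d) peval (e i j) (eta0 u)
        :=: orth 1%:M (orth (Gbar psi th (eta0 u)) ('J eta0 u)))%MS)
  (G : seq (mpoly (d + d) R)) (groebner : groebner_basis (@I2 R d) G)
  (r : 'I_p -> mpoly (d + d) R)
  (remainder : forall i, normal_form G (linear_form (e i)) (r i)) :
  (forall i, eta_degree_le 1 (r i))
  /\ estimating_equations_for_first_order_efficient U0 ustar eta0
       (Gbar psi th) (fun i X u => eval_X_eta (r i) X (eta0 u)).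
Proof.
split; first by move=> i; exact: normal_form_eta_degree groebner (remainder i).
have /choice[c cP] i : exists c, r i = diagonal_form c /\
    forall j x, eval_X_eta (c j) x x = peval (e i j) x.
  by have [c rc cx] := normal_form_diagonal groebner (remainder i); exists c.
pose slope u X : 'M[R]_(p, d) := \matrix_(i, j) eval_X_eta (c i j) X (eta0 u).
have leafE u X : leaf_eq eta0 slope u X = \row_i eval_X_eta (r i) X (eta0 u).
  apply/rowP => i; rewrite [RHS]mxE (cP i).1 eval_diagonal_form mxE.
  by apply: eq_bigr => j _; rewrite [_^T _ _]mxE [slope _ _ _ _]mxE.
have oU0 := rparam_open param; have seta0 := rparam_smooth param.
have sslope k i j : Ck k [set z : 'rV[R]_(p + d) | U0 (lsubmx z)]
    (fun z => slope (lsubmx z) (rsubmx z) i j).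
  have oO := open_lsub (n := d) oU0.
  have := Ck_peval (c i j) oO (Ck_row_mx oO
    (smooth_eta0_lsub oU0 seta0 k d) (Ck_rsub k oO)).
  by apply: (Ck_ext oO) => z _; rewrite mxE.
have slopeE u : U0 u -> (slope u (eta0 u) :=:
    orth 1%:M (orth (Gbar psi th (eta0 u)) ('J eta0 u)))%MS.
  move=> Uu; have -> : slope u (eta0 u) = \matrix_(i, j) peval (e i j) (eta0 u).
    by apply/matrixP => i j; rewrite !mxE (cP i).2.
  exact: e_span.
have Gpos u : U0 u -> positive_definite (Gbar psi th (eta0 u)).
  move=> Uu; apply/positive_definite_inv/(expfam_fisher family).
  exact/(linv_dom inverse)/param_dom.
split.
  have Us := rparam_true param.
  have trans : 'J eta0 ustar *m (slope ustar (eta0 ustar))^T \in unitmx.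
    apply: transversality (Gpos _ Us) _ (slopeE _ Us).
    by rewrite /row_free (rparam_rank param).
  have [W [eta [est leaf]]] := leaf_coordinates oU0 seta0 sslope Us trans lt_pd.
  exists W, eta; split=> // u v Wuv i.
  have := leaf _ Wuv; rewrite row_mxKl leafE => /rowP/(_ i).
  by rewrite !mxE.
move=> W eta est sat u Wu kappa a.
have Uu := est_dom est Wu; have etau := est_extends est Wu.
have leaf w : W w -> leaf_eq eta0 slope (lsubmx w) (eta w) = 0.
  rewrite -{1}[w]hsubmxK => Ww; rewrite leafE; apply/rowP => i.
  by have := sat _ _ Ww i; rewrite hsubmxK !mxE.
have WU0 w : W w -> U0 (lsubmx w).
  by rewrite -{1}[w]hsubmxK; exact: (est_dom est).
have deta : differentiable eta (row_mx u 0).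
  exact: Ck_differentiable (est_smooth est 1) Wu.
have kE : lsubmx (delta_mx 0 (rshift p kappa) : 'rV[R]_(p + (d - p))) = 0.
  by apply/rowP => j; rewrite !mxE eqxx eq_lrshift.
have := leaf_tangent oU0 seta0 sslope (est_open est) WU0 (est_smooth est) leaf
  Wu etau kE.
rewrite -(jacobian_row _ deta).
move=> /(double_orth_annihilator (slopeE u Uu)); rewrite etau.
have -> : row (lshift (d - p) a) ('J eta (row_mx u 0)) = row a ('J eta0 u).
  have du : differentiable eta0 u := Ck_differentiable (seta0 1) Uu.
  rewrite (jacobian_row _ deta) (jacobian_row _ du).
  pose inj : 'rV[R]_p -> 'rV[R]_(p + (d - p)) := mulmxr (row_mx 1%:M 0).
  have cinj : continuous inj by exact: mulmxr_continuous.
  have injE u' : inj u' = row_mx u' 0 by rewrite /inj /= mul_mx_row mulmx1 mulmx0.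
  (* The restriction of eta to v = 0 is eta0 only where W is known to contain
     (u', 0), so the derivatives are compared through a germ at u. *)
  have near_eta0 : \forall u' \near u, eta (inj u') = eta0 u'.
    have near_W : \forall w \near inj u, W w.
      by apply: open_nbhs_nbhs; split; [exact: est_open est | rewrite injE].
    have near_u : \forall u' \near u, W (inj u') := cinj u _ near_W.
    by apply: filterS near_u => u'; rewrite injE; exact: (est_extends est).
  rewrite -(near_eq_derive (delta_mx 0 a) near_eta0).
  have dinj : differentiable inj u by exact: linear_differentiable.
  rewrite -(injE u) in deta *.
  rewrite (derive_val (is_derive := is_derive_comp (delta_mx 0 a) dinj deta)).
  rewrite -deriveE //.
  rewrite (derive_val (is_derive := is_derive_linear u (delta_mx 0 a) cinj)).
  congr (derive _ _ _); transitivity (inj (delta_mx 0 a)) => //; rewrite injE.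
  apply/rowP => j; rewrite -(splitK j); case: (fintype.split j) => k /=.
    by rewrite row_mxEl !mxE eq_lshift.
  by rewrite row_mxEr !mxE eq_rlshift.
rewrite tr_row => wJ.
have := congr1 (fun M : 'rV[R]_p => M 0 a) wJ; rewrite mxE [RHS]mxE => <-.
rewrite mxE; apply: eq_bigr => k _; congr (_ * _).
by rewrite !mxE.
Qed.
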